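(* Let $1\le n<m$ and fix non-zero complex numbers $q_{ij}$, $1\le i<j\le m$, such that $q_{ij}=q_{i'j'}$ whenever $i,i'\le n$ and $j,j'>n$. Let $A=(a_{ij})_{m\times m}$ be a $\mathbf q$-right-quantum matrix, i.e. the following hold in the algebra in which we compute: $$a_{jk}a_{ik}=q_{ij}\,a_{ik}a_{jk}\quad (i<j),\qquad a_{ik}a_{jl}-q_{ij}^{-1}a_{jk}a_{il}=q_{kl}q_{ij}^{-1}\,a_{jl}a_{ik}-q_{kl}\,a_{il}a_{jk}\quad (i<j,\ k<l).$$ For $n<i,j\le m$ put $$c^{\mathbf q}_{ij}=-\,{\det}_{\mathbf q}^{-1}(I-A_0)\cdot {\det}_{\mathbf q}\begin{pmatrix} I-A_0 & -a_{*j}\\ -a_{i*} & -a_{ij}\end{pmatrix},\qquad C^{\mathbf q}=(c^{\mathbf q}_{ij})_{n+1\le i,j\le m}.$$ Then $${\det}_{\mathbf q}^{-1}(I-A_0)\cdot {\det}_{\mathbf q}(I-A)={\det}_{\mathbf q}(I-C^{\mathbf q}).$$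
   Context: $\mathcal A$ is the $\mathbb C$-algebra of formal power series (infinite linear combinations of finite words) in non-commuting variables $a_{ij}$, $1\le i,j\le m$; all identities are taken in the quotient of $\mathcal A$ by the closed two-sided ideal generated by the stated relations. $A_0=(a_{ij})_{1\le i,j\le n}$, $a_{i*}=(a_{i1},\dots,a_{in})$ is a row vector, $a_{*j}=(a_{1j},\dots,a_{nj})^T$ a column vector. For words $\lambda=\lambda_1\cdots\lambda_\ell$, $\mu=\mu_1\cdots\mu_\ell$ over $\{1,\dots,m\}$ write $a_{\lambda,\mu}=a_{\lambda_1\mu_1}\cdots a_{\lambda_\ell\mu_\ell}$, let $\mathcal I(\nu)=\{(s,t):s<t,\ \nu_s>\nu_t\}$, $\operatorname{inv}\nu=|\mathcal I(\nu)|$, and define the weight $w(\lambda,\mu)=\prod_{(s,t)\in\mathcal I(\mu)}q_{\mu_t\mu_s}\prod_{(s,t)\in\mathcal I(\lambda)}q_{\lambda_t\lambda_s}^{-1}$. For a square matrix $B=(b_{rs})_{1\le r,s\le N}$ with row labels $\rho_1<\dots<\rho_N$ and column labels $\kappa_1<\dots<\kappa_N$ in $\{1,\dots,m\}$, whose entries $b_{rs}$ are linear combinations of $1$ and $a_{\rho_r\kappa_s}$, ${\det}_{\mathbf q}B$ is obtained by expanding $\sum_{\sigma\in S_N}(-1)^{\operatorname{inv}\sigma}b_{\sigma(1)1}\cdots b_{\sigma(N)N}$ into a linear combination of words $a_{\lambda,\mu}$ (with $\lambda$ the row labels and $\mu$ the column labels used) and multiplying each word $a_{\lambda,\mu}$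 by $w(\lambda,\mu)$. This applies to $I-A$ (labels $1,\dots,m$), $I-A_0$ (labels $1,\dots,n$) and to the bordered matrix above, whose rows are labelled $1,\dots,n,i$ and columns $1,\dots,n,j$. ${\det}_{\mathbf q}(I-A_0)$ has constant term $1$ and ${\det}_{\mathbf q}^{-1}(I-A_0)$ denotes its inverse. The determinant ${\det}_{\mathbf q}(I-C^{\mathbf q})$ is computed treating the $c^{\mathbf q}_{ij}$ as letters: ${\det}_{\mathbf q}(I-C^{\mathbf q})=\sum_{J\subseteq\{n+1,\dots,m\}}(-1)^{|J|}\sum_{\sigma\in S_J}(-1)^{\operatorname{inv}\sigma}\,w(\sigma(j_1)\cdots\sigma(j_k),j_1\cdots j_k)\,c^{\mathbf q}_{\sigma(j_1)j_1}\cdots c^{\mathbf q}_{\sigma(j_k)j_k}$, where $J=\{j_1<\dots<j_k\}$ and $\operatorname{inv}\sigma$ is the number of inversions of the word $\sigma(j_1)\cdots\sigma(j_k)$. *)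

(* Defs.v *)
From HB Require Import structures.
From mathcomp Require Import all_boot all_order all_algebra all_fingroup.
From mathcomp Require Import all_classical all_reals.
From mathcomp Require Import topology_structure discrete_topology function_spaces.
From mathcomp Require Import complex.

Set Implicit Arguments.
Unset Strict Implicit.
Unset Printing Implicit Defensive.

Import GRing.Theory.

Local Open Scope ring_scope.

(* Formal power series over K in the non-commuting variables V: the series f  *)
(* is the infinite sum of the (f w) * w, for w a word (sequence of letters).  *)
(* This is an alias: its product is the Cauchy product defined below, not the *)
(* pointwise product of functions.                                            *)
Definition ncfps (K : fieldType) (V : Type) : Type := seq V -> K.

HB.instance Definition _ (K : fieldType) (V : Type) :=
  Choice.copy (ncfps K V) (seq V -> K^o).
HB.instance Definition _ (K : fieldType) (V : Type) :=
  GRing.Lmodule.copy (ncfps K V) (seq V -> K^o).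

(* Coefficientwise convergence, K being discrete. When V is finite this is    *)
(* the usual topology of formal power series, in which two series are close   *)
(* when their coefficients agree on all words of length at most some large N. *)
HB.instance Definition _ (K : fieldType) (V : Type) :=
  Topological.copy (ncfps K V) {ptws seq V -> discrete_topology K}.

Section NcfpsAlgebra.
Variables (K : fieldType) (V : Type).
Local Notation A := (ncfps K V).
Implicit Types (f g h : A) (w u : seq V) (x : V).

Lemma ncfpsD f g w : (f + g) w = f w + g w. Proof. by []. Qed.

Lemma ncfpsN f w : (- f) w = - f w. Proof. by []. Qed.

Lemma ncfpsZ (c : K) f w : (c *: f) w = c * f w. Proof. by []. Qed.

Definition ncfps_one : A := fun w => (nilp w)%:R.

Definition ncfps_mul f g : A :=
  fun w => \sum_(k < (size w).+1) f (take k w) * g (drop k w).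

Definition ncfps_lder x f : A := fun w => f (x :: w).

Fact ncfps_mul_cons f g x w :
  ncfps_mul f g (x :: w) = f [::] * g (x :: w) + ncfps_mul (ncfps_lder x f) g w.
Proof. by rewrite /ncfps_mul /= big_ord_recl. Qed.

Fact ncfps_mul_nil f g : ncfps_mul f g [::] = f [::] * g [::].
Proof. by rewrite /ncfps_mul big_ord1. Qed.

Fact ncfps_mulDl : left_distributive ncfps_mul +%R.
Proof.
move=> f g h; apply/funext => w; rewrite ncfpsD /ncfps_mul.
by rewrite -big_split; apply: eq_bigr => k _; rewrite ncfpsD mulrDl.
Qed.

Fact ncfps_mulDr : right_distributive ncfps_mul +%R.
Proof.
move=> f g h; apply/funext => w; rewrite ncfpsD /ncfps_mul.
by rewrite -big_split; apply: eq_bigr => k _; rewrite ncfpsD mulrDr.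
Qed.

Fact ncfps_mulZl (c : K) f g : c *: ncfps_mul f g = ncfps_mul (c *: f) g.
Proof.
apply/funext => w; rewrite ncfpsZ /ncfps_mul.
by rewrite mulr_sumr; apply: eq_bigr => k _; rewrite ncfpsZ mulrA.
Qed.

Fact ncfps_mulZr (c : K) f g : c *: ncfps_mul f g = ncfps_mul f (c *: g).
Proof.
apply/funext => w; rewrite ncfpsZ /ncfps_mul.
by rewrite mulr_sumr; apply: eq_bigr => k _; rewrite ncfpsZ mulrCA.
Qed.

Fact ncfps_mulA : associative ncfps_mul.
Proof.
move=> f g h; apply/funext => w; elim: w f => [|x w IHw] f.
  by rewrite !ncfps_mul_nil mulrA.
have -> : ncfps_mul (ncfps_mul f g) h (x :: w) =
  ncfps_mul f g [::] * h (x :: w)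
  + ncfps_mul (f [::] *: ncfps_lder x g + ncfps_mul (ncfps_lder x f) g) h w.
  rewrite ncfps_mul_cons; congr (_ + ncfps_mul _ _ _).
  by apply/funext => u; rewrite /ncfps_lder ncfps_mul_cons.
rewrite ncfps_mulDl -ncfps_mulZl ncfps_mul_cons ncfps_mul_cons.
rewrite ncfps_mul_nil mulrDr IHw mulrA -addrA.
by congr (_ + _).
Qed.

Fact ncfps_mul1f : left_id ncfps_one ncfps_mul.
Proof.
move=> f; apply/funext => -[|x w]; first by rewrite ncfps_mul_nil mul1r.
rewrite ncfps_mul_cons mul1r /ncfps_mul big1 ?addr0 // => k _.
by rewrite /ncfps_lder /ncfps_one mul0r.
Qed.

Fact ncfps_mulf1 : right_id ncfps_one ncfps_mul.
Proof.
move=> f; apply/funext => w; elim: w f => [|x w IHw] f.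
  by rewrite ncfps_mul_nil mulr1.
by rewrite ncfps_mul_cons mulr0 add0r IHw.
Qed.

Fact ncfps_one_neq0 : ncfps_one != 0.
Proof.
by apply/eqP => /(congr1 (fun f : A => f [::])) /eqP; rewrite oner_eq0.
Qed.

HB.instance Definition _ := GRing.Zmodule_isNzRing.Build A
  ncfps_mulA ncfps_mul1f ncfps_mulf1 ncfps_mulDl ncfps_mulDr ncfps_one_neq0.
HB.instance Definition _ := GRing.Lmodule_isLalgebra.Build K A ncfps_mulZl.
HB.instance Definition _ := GRing.Lalgebra_isAlgebra.Build K A ncfps_mulZr.

Lemma ncfps1E w : (1 : A) w = (nilp w)%:R. Proof. by []. Qed.

Lemma ncfpsM f g w :
  (f * g) w = \sum_(k < (size w).+1) f (take k w) * g (drop k w).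
Proof. by []. Qed.

Lemma ncfps_sumE (I : Type) (r : seq I) (P : pred I) (F : I -> A) w :
  (\sum_(i <- r | P i) F i) w = \sum_(i <- r | P i) F i w.
Proof. by elim/big_rec2: _ => // i y1 y2 _ <-. Qed.

Lemma ncfpsM_nil f g : (f * g) [::] = f [::] * g [::].
Proof. exact: ncfps_mul_nil. Qed.

Lemma ncfps_prod_nil (I : Type) (r : seq I) (P : pred I) (F : I -> A) :
  (\prod_(i <- r | P i) F i) [::] = \prod_(i <- r | P i) F i [::].
Proof. by elim/big_rec2: _ => // i y1 y2 _ <-; rewrite ncfpsM_nil. Qed.

Lemma ncfps_exp_small f k w :
  f [::] = 0 -> (size w < k)%N -> (f ^+ k) w = 0.
Proof.
move=> f0; elim: k w => // k IHk w ltwk; rewrite exprS ncfpsM big1 // => i _.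
case: w ltwk i => [|x w] ltwk [[|i] lti] /=; rewrite ?f0 ?mul0r //.
rewrite IHk ?mulr0 // size_drop.
by rewrite (leq_ltn_trans (leq_subr _ _)).
Qed.

(* An invertible series is f = c (1 - h) with c <> 0 and h without constant   *)
(* term, and its inverse is the geometric series (\sum_k h ^ k) / c, where    *)
(* only the k at most the length of w contribute to the coefficient of w.     *)
Definition ncfps_inv f : A :=
  if f [::] == 0 then f else
  fun w => (f [::])^-1 *
    (\sum_(k < (size w).+1) (1 - (f [::])^-1 *: f) ^+ k) w.

Fact ncfps_invE f w N : f [::] != 0 -> (size w <= N)%N ->
  ncfps_inv f w =
    ((f [::])^-1 *: \sum_(k < N.+1) (1 - (f [::])^-1 *: f) ^+ k) w.
Proof.
move=> f0 lewN; rewrite /ncfps_inv (negPf f0) ncfpsZ; congr (_ * _).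
rewrite -(subnK lewN); elim: (N - size w)%N => // d ->.
rewrite addSn [in RHS]big_ord_recr /= ncfpsD ncfps_exp_small ?addr0 //.
  by rewrite ncfpsD ncfpsN ncfpsZ mulVf // subrr.
by rewrite ltnS leq_addl.
Qed.

Fact ncfps_geom_base f : 1 - (1 - (f [::])^-1 *: f) = (f [::])^-1 *: f.
Proof. by rewrite opprB addrC subrK. Qed.

Fact ncfps_geomE (h : A) N : (1 - h) * (\sum_(k < N) h ^+ k) = 1 - h ^+ N.
Proof.
elim: N => [|N IHN]; first by rewrite big_ord0 mulr0 expr0 subrr.
by rewrite big_ord_recr mulrDr IHN mulrBl mul1r -exprS addrA subrK.
Qed.

Fact ncfps_geom_comm (h : A) N : GRing.comm (1 - h) (\sum_(k < N) h ^+ k).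
Proof.
apply: commr_sym; apply: commrB; first exact: commr1.
apply: commr_sym; apply: commr_sum => k _; exact: commrX.
Qed.

Definition ncfps_unit : pred A := fun f => f [::] != 0.

Fact ncfps_geom_rem f w : f [::] != 0 ->
  ((1 - (f [::])^-1 *: f) ^+ (size w).+1) w = 0.
Proof.
move=> f0; apply: ncfps_exp_small => //.
by rewrite ncfpsD ncfpsN ncfpsZ mulVf // subrr.
Qed.

Fact ncfps_mulVf : {in ncfps_unit, left_inverse 1 ncfps_inv *%R}.
Proof.
move=> f f0; have {}f0 : f [::] != 0 := f0; apply/funext => w.
transitivity ((((f [::])^-1 *: \sum_(k < (size w).+1)
  (1 - (f [::])^-1 *: f) ^+ k) * f) w).
  rewrite !ncfpsM; apply: eq_bigr => k _; congr (_ * _).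
  by apply: ncfps_invE => //; rewrite size_take; case: ifP => // /ltnW.
set h := 1 - _; set G := \sum_(k < _) _.
have -> : (f [::])^-1 *: G * f = G * (1 - h).
  by rewrite ncfps_geom_base -scalerAl -scalerAr.
by rewrite -ncfps_geom_comm ncfps_geomE ncfpsD ncfpsN ncfps_geom_rem // subr0.
Qed.

Fact ncfps_mulfV : {in ncfps_unit, right_inverse 1 ncfps_inv *%R}.
Proof.
move=> f f0; have {}f0 : f [::] != 0 := f0; apply/funext => w.
transitivity ((f * ((f [::])^-1 *: \sum_(k < (size w).+1)
  (1 - (f [::])^-1 *: f) ^+ k)) w).
  rewrite !ncfpsM; apply: eq_bigr => k _; congr (_ * _).
  by apply: ncfps_invE => //; rewrite size_drop leq_subr.
set h := 1 - _; set G := \sum_(k < _) _.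
have -> : f * ((f [::])^-1 *: G) = (1 - h) * G.
  by rewrite ncfps_geom_base -scalerAl -scalerAr.
by rewrite ncfps_geomE ncfpsD ncfpsN ncfps_geom_rem // subr0.
Qed.

Fact ncfps_unitP f g : g * f = 1 /\ f * g = 1 -> ncfps_unit f.
Proof.
case=> /(congr1 (fun f : A => f [::])); rewrite ncfpsM_nil => gf1 _.
by apply/eqP => f0; move/eqP: gf1; rewrite f0 mulr0 eq_sym oner_eq0.
Qed.

Fact ncfps_inv_out : {in [predC ncfps_unit], ncfps_inv =1 id}.
Proof. by move=> f; rewrite inE negbK /ncfps_inv => ->. Qed.

HB.instance Definition _ := GRing.NzRing_hasMulInverse.Build A
  ncfps_mulVf ncfps_mulfV ncfps_unitP ncfps_inv_out.

Lemma ncfps_unitE f : (f \is a GRing.unit) = (f [::] != 0).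
Proof. by []. Qed.

Definition two_sided_ideal (I : set A) : Prop :=
  [/\ I 0, forall f g, I f -> I g -> I (f + g)
    & forall f g h, I g -> I (f * g * h)].

Definition closed_ideal (S : set A) : set A :=
  smallest [set I | two_sided_ideal I /\ closed I]%classic S.

(* Equality of the classes of f and g in the quotient of the algebra of       *)
(* series by the closed two-sided ideal generated by S.                       *)
Definition eq_modulo (S : set A) f g : Prop := closed_ideal S (f - g).

End NcfpsAlgebra.

Definition ncfps_var (K : fieldType) (V : eqType) (x : V) : ncfps K V :=
  fun w => (w == [:: x])%:R.

Section Words.
Variables (K : fieldType) (m : nat) (q : 'I_m -> 'I_m -> K).

Local Notation "nu `_[ s ]" := (tnth (in_tuple nu) s) (at level 2).

Definition inversions (nu : seq 'I_m) : {set 'I_(size nu) * 'I_(size nu)} :=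
  [set st : 'I_(size nu) * 'I_(size nu) |
    (st.1 < st.2)%N && (nu `_[st.2] < nu `_[st.1])%N].

Definition inv_word (nu : seq 'I_m) : nat := #|inversions nu|.

(* Only the values q i j with i < j are used. *)
Definition weight (la mu : seq 'I_m) : K :=
  (\prod_(st in inversions mu) q (mu `_[st.2]) (mu `_[st.1])) *
  \prod_(st in inversions la) (q (la `_[st.2]) (la `_[st.1]))^-1.

Lemma weight_nil : weight [::] [::] = 1.
Proof. by rewrite /weight !big1 ?mulr1 // => -[[]]. Qed.

End Words.

Section QDet.
Variables (K : fieldType) (m : nat) (q : 'I_m -> 'I_m -> K).
Local Notation A := (ncfps K ('I_m * 'I_m)%type).

(* The letter (i, j) stands for a_ij; hence the word a_{la,mu} is zip la mu,  *)
(* and la and mu are recovered as its first and second projections.           *)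
Definition letter (i j : 'I_m) : A := ncfps_var K (i, j).

Definition amx : 'M[A]_m := \matrix_(i, j) letter i j.

Definition weigh_words (f : A) : A :=
  fun w => weight q (unzip1 w) (unzip2 w) * f w.

(* The row and column labels of B are carried by the letters a_ij occurring   *)
(* in its entries.                                                            *)
Definition qdet (N : nat) (B : 'M[A]_N) : A :=
  weigh_words (\sum_(s : 'S_N)
    (-1) ^+ inv_word [seq s r | r <- enum 'I_N] * \prod_(r < N) B (s r) r).

(* The series set to zero by requiring amx to be q-right-quantum. *)
Definition right_quantum_relators : set A :=
  [set f |
   (exists i j k : 'I_m, (i < j)%N /\
     f = letter j k * letter i k - q i j *: (letter i k * letter j k)) \/
   (exists i j k l : 'I_m, [/\ (i < j)%N, (k < l)%N &
     f = (letter i k * letter j l - (q i j)^-1 *: (letter j k * letter i l))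
       - ((q k l * (q i j)^-1) *: (letter j l * letter i k)
          - q k l *: (letter i l * letter j k))])]%classic.

Section Schur.
Variables (n : nat) (ltnm : (n < m)%N).

Local Notation emb := (widen_ord (ltnW ltnm)).

Definition amx0 : 'M[A]_n := mxsub emb emb amx.

Lemma qdet_amx0_nil : qdet (1%:M - amx0) [::] = 1.
Proof.
rewrite /qdet /weigh_words weight_nil mul1r ncfps_sumE (bigD1 1%g) //=.
rewrite [X in _ + X]big1 ?addr0 => [|s s1].
  rewrite ncfpsM_nil ncfps_prod_nil.
  have -> : inv_word [seq (1%g : 'S_n) r | r <- enum 'I_n] = 0%N.
    rewrite (eq_map (g := id)) ?map_id => [|r]; last by rewrite perm1.
    apply/eqP; rewrite cards_eq0; apply/eqP/setP => -[i j]; rewrite !inE /=.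
    have lti : (i < n)%N by rewrite -[X in (_ < X)%N]size_enum_ord ltn_ord.
    have ltj : (j < n)%N by rewrite -[X in (_ < X)%N]size_enum_ord ltn_ord.
    rewrite !(tnth_nth (Ordinal lti)) /= !nth_enum_ord //.
    by case: ltngtP.
  rewrite expr0 mul1r big1 // => r _.
  by rewrite perm1 !mxE eqxx ncfpsD ncfpsN subr0.
have [r srr] : exists r, s r != r.
  apply/existsP; apply: contraNT s1; rewrite negb_exists => /forallP s1.
  by apply/eqP/permP => r; rewrite perm1; apply/eqP; rewrite -[_ == _]negbK.
rewrite ncfpsM_nil ncfps_prod_nil (bigD1 r) //= !mxE (negPf srr).
by rewrite ncfpsD ncfpsN subr0 mul0r mulr0.
Qed.

Lemma qdet_amx0_unit : qdet (1%:M - amx0) \is a GRing.unit.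
Proof. by rewrite ncfps_unitE qdet_amx0_nil oner_eq0. Qed.

Definition bordered_mx (i j : 'I_m) : 'M[A]_(n + 1) :=
  block_mx (1%:M - amx0)                 (- \col_k letter (emb k) j)
           (- \row_k letter i (emb k))   (- letter i j)%:M.

Definition cq (i j : 'I_m) : A :=
  - ((qdet (1%:M - amx0))^-1 * qdet (bordered_mx i j)).

(* The q-determinant of I - C for C with rows and columns labelled by the     *)
(* i in 'I_m with n <= i, expanded over principal submatrices; enum J lists   *)
(* J in increasing order, and s in Sym J is a permutation of J extended by    *)
(* the identity.                                                              *)
Definition qdet_one_minus (c : 'I_m -> 'I_m -> A) : A :=
  \sum_(J : {set 'I_m} | J \subset [set i : 'I_m | (n <= i)%N]%SET)
    (-1) ^+ #|J| *
    \sum_(s in Sym J)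
      (-1) ^+ inv_word [seq s j | j <- enum J] *
      (weight q [seq s j | j <- enum J] (enum J)
         *: \prod_(j <- enum J) c (s j) j).

End Schur.

End QDet.

Arguments amx K m : clear implicits.
Arguments amx0 K {m n} ltnm.

(* Main.v *)
Require Import Defs.
From mathcomp Require Import all_boot all_order all_algebra all_fingroup.
From mathcomp Require Import all_classical all_reals complex.
From mathcomp Require Import topology_structure discrete_topology function_spaces supremum_topology nat_topology.

Local Open Scope ring_scope.
Local Open Scope complex_scope.

(* Multiplying the coefficient of each word a_{la,mu} by w(la,mu) turns the   *)
(* relators at q = 1 into the q-relators, and it is multiplicative on the     *)
(* products that occur here: det^-1(1 - A_0) has equally many row and column  *)
(* labels of each value, and the entries of C add labels at most n only in    *)
(* equal numbers, where q_ij depends on neither i nor j. This reduces the     *)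
(* theorem to q = 1. There the columns phi_j = \sum_i e_i (1 - A)_ij          *)
(* anticommute and square to zero in the exterior algebra with coefficients   *)
(* in the quotient. Hence, to the right of phi_1 ... phi_n, each phi_j with   *)
(* j > n may be replaced by phi_j - \sum_(k <= n) phi_k y_kj; if y solves    *)
(* (1 - A_0) y_j = - a_{*j}, this kills the first n rows, which gives         *)
(* det(1 - A) = det(1 - A_0) det S and identifies S with 1 - C.               *)

(** At q = 1 the identity is a Schur complement formula. The determinant of [1 - A] is the top
    coefficient of the product of its columns in the exterior algebra, and the right-quantum
    relations make these columns anticommute and square to zero ([wedge_one_minus_col_anticomm],
    [wedge_one_minus_col_sqr]). Column operations on the columns above n are then allowed
    ([wedges_column_ops]); they make the matrix block triangular with diagonal blocks [1 - A_0] and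
    the Schur complement S, so det(1 - A) = det(1 - A_0) det S ([det_schur]). The same operation on
    a bordered matrix gives det(1 - A_0) (S_ij - delta_ij) ([bordered_schur]), hence S = 1 - C.
    Finally det(1 - C) is the signed sum of the principal minors of C, whatever the entries
    ([wedges_one_minus]). [manin_schur] collects this modulo any ideal containing the relators.

    For general q, the weight of a concatenation is the product of the weights times a factor for
    the inversions across the cut ([weight_cat]), which depends only on the multisets of labels.
    Hence the series whose twisted bidegree parts lie in a closed ideal form an ideal themselves
    ([untwistedM]), which contains the relators at q = 1 ([untwisted_col], [untwisted_cross]).
    [manin_schur] applies to it and [untwistedP] returns to the closed ideal. What remains is to
    twist both sides: the factor across the cut is 1 for balanced series ([twistM_balanced]), and in
    products of entries of C it reduces to the weight of the outer labels ([twist_prod]). *)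

Section Inversions.
Set Implicit Arguments.
Unset Strict Implicit.
Import Monoid.Theory.
Variables (T : Type) (idx : T) (op : Monoid.com_law idx) (m : nat).
Variable F : 'I_m -> 'I_m -> T.
Implicit Types u v : seq 'I_m.

(** Over a general monoid, so that the number of inversions ([addn]) and the weight of a word (a
    product of [q]) obey one concatenation rule. *)
Definition big_inv u : T :=
  \big[op/idx]_(st in inversions u)
     F (tnth (in_tuple u) st.1) (tnth (in_tuple u) st.2).

Lemma big_inv_nil : big_inv [::] = idx.
Proof. by rewrite /big_inv big1 // => -[[]]. Qed.

Lemma big_inv_cons x u :
  big_inv (x :: u) = op (\big[op/idx]_(y <- u | (y < x)%N) F x y) (big_inv u).
Proof.
have E w : big_inv w = \big[op/idx]_(s < size w) \big[op/idx]_(t < size w |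
    (s < t)%N && (tnth (in_tuple w) t < tnth (in_tuple w) s)%N)
    F (tnth (in_tuple w) s) (tnth (in_tuple w) t).
  rewrite /big_inv pair_big_dep /=; apply: eq_bigl => -[s t].
  by rewrite inE.
rewrite !E big_ord_recl; congr (op _ _).
  rewrite big_tnth [LHS]big_mkcond big_ord_recl /= mul1m [RHS]big_mkcond /=.
  apply: eq_bigr => t _; rewrite !(tnth_nth x) /=; congr (if _ then _ else _).
apply: eq_bigr => s _; rewrite [LHS]big_mkcond big_ord_recl /= mul1m.
rewrite [RHS]big_mkcond /=; apply: eq_bigr => t _.
by rewrite !(tnth_nth x) /=.
Qed.

Lemma big_inv_cat u v : big_inv (u ++ v) =
  op (\big[op/idx]_(x <- u) \big[op/idx]_(y <- v | (y < x)%N) F x y)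
     (op (big_inv u) (big_inv v)).
Proof.
have ac a b c d e : op (op a b) (op c (op d e)) = op (op b c) (op (op a d) e).
  by rewrite -[X in _ = op _ X]mulmA [op a b]mulmC mulmACA.
elim: u => [|x u IHu] /=; first by rewrite big_nil big_inv_nil !mul1m.
by rewrite !big_inv_cons IHu big_cons big_cat /= ac.
Qed.

End Inversions.

(** * The exterior algebra with coefficients in a non-commutative ring *)

Section Grassmann.
Set Implicit Arguments.
Unset Strict Implicit.
Import GRing.Theory.

Lemma inv_word_rcons m (t : seq 'I_m) x :
  inv_word (rcons t x) = (inv_word t + count (fun y : 'I_m => x < y) t)%N.
Proof.
have E u : inv_word u = big_inv addn (fun _ _ => 1%N) u.
  by rewrite /big_inv /inv_word sum1_card.
rewrite !E -cats1 big_inv_cat big_inv_cons big_inv_nil big_nil /= !addn0 addnC.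
congr addn; rewrite -sum1_count [RHS]big_mkcond; apply: eq_bigr => y _.
by rewrite big_mkcond big_seq1.
Qed.

Lemma sorted_enum_set m (K : {set 'I_m}) :
  sorted (fun x y : 'I_m => x < y)%N (enum K).
Proof.
rewrite /enum_mem -enumT; apply: sorted_filter; first by move=> x y z; apply: ltn_trans.
have := iota_ltn_sorted 0 m.
by rewrite -val_enum_ord sorted_map.
Qed.

Lemma sorted_ord_inj m (s t : seq 'I_m) :
  sorted (fun x y : 'I_m => x < y)%N s -> sorted (fun x y : 'I_m => x < y)%N t ->
  s =i t -> s = t.
Proof.
apply: irr_sorted_eq; first by move=> x y z; apply: ltn_trans.
by move=> x; rewrite /= ltnn.
Qed.

(** Needed for deleting [j] both as a row and as a column: the number of columns after [j] is the
    exponent of the sign that [wedge] gives to row [j]. *)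
Lemma enum_setD1_split m (K : {set 'I_m}) j : j \in K ->
  exists l1 l2, [/\ enum K = l1 ++ j :: l2, enum (K :\ j) = l1 ++ l2,
    (j \notin l1) && (j \notin l2) &
    size l2 = #|[set y in K | (j < y)%N]|].
Proof.
move=> jK; have: j \in enum K by rewrite mem_enum.
case/splitPr E: _ / => [l1 l2]; exists l1, l2.
have trl : transitive (fun x y : 'I_m => (x < y)%N).
  by move=> x y z; apply: ltn_trans.
have := sorted_enum_set K; have := enum_uniq K.
rewrite E cat_uniq /= !negb_or => /and3P[_ /andP[jl1 _] /andP[jl2 _]] sE.
have := sE; rewrite (sorted_pairwise trl) pairwise_cat /=.
rewrite allrel_consr -!andbA => /and5P[/allP lt1 _ _ /allP lt2 pl2].
split=> //; last 2 first.
- by rewrite jl1.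
- rewrite cardE; congr size; apply: sorted_ord_inj.
  + by rewrite (sorted_pairwise trl).
  + exact: sorted_enum_set.
  move=> y; rewrite mem_enum inE -(mem_enum K) E mem_cat inE.
  case yl2: (y \in l2); first by rewrite (lt2 _ yl2) !orbT.
  rewrite orbF; apply/esym/negP => /andP[/orP[/lt1 yj|/eqP->]]; last by rewrite ltnn.
  by rewrite ltnNge ltnW.
apply: sorted_ord_inj; first exact: sorted_enum_set.
  by apply: (subseq_sorted trl) sE; rewrite cat_subseq ?subseq_cons.
move=> y; rewrite mem_enum !inE -(mem_enum K) E !mem_cat inE.
by case: eqVneq => //= ->; rewrite (negPf jl1) (negPf jl2).
Qed.

Variables (m : nat) (A : nzRingType).
Implicit Types (K D : {set 'I_m}) (v w : {set 'I_m} -> A) (c d : 'I_m -> A).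

Definition above (x : 'I_m) K := #|[set y in K | (x < y)%N]|.

(* The function v stands for the element \sum_K e_K * v K of the exterior     *)
(* algebra with coefficients in A, and wedge c is right multiplication by     *)
(* \sum_x e_x * c x.                                                          *)
Definition wedge c v K : A :=
  \sum_(x in K) (-1) ^+ above x K * (v (K :\ x) * c x).

Definition wedges (I : Type) (phi : I -> 'I_m -> A) (js : seq I) v :=
  foldl (fun v j => wedge (phi j) v) v js.

(** The unit of the exterior algebra. *)
Definition vac K : A := (K == finset.set0)%:R.

Definition basis_vec (j x : 'I_m) : A := (x == j)%:R.

Lemma wedge_eq c d v w K :
  (forall x, x \in K -> c x = d x) ->
  (forall x, x \in K -> v (K :\ x) = w (K :\ x)) -> wedge c v K = wedge d w K.
Proof. by move=> cd vw; apply: eq_bigr => x xK; rewrite cd ?vw. Qed.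

Lemma wedgeDl c d v K :
  wedge (fun x => c x + d x) v K = wedge c v K + wedge d v K.
Proof. by rewrite -big_split; apply: eq_bigr => x _ /=; rewrite !mulrDr. Qed.

Lemma wedgeNl c v K : wedge (fun x => - c x) v K = - wedge c v K.
Proof. by rewrite -sumrN; apply: eq_bigr => x _ /=; rewrite !mulrN. Qed.

Lemma wedgeDr c v w K :
  wedge c (fun K => v K + w K) K = wedge c v K + wedge c w K.
Proof.
by rewrite -big_split; apply: eq_bigr => x _ /=; rewrite mulrDl !mulrDr.
Qed.

Lemma wedgeZr a c v K : wedge c (fun K => a * v K) K = a * wedge c v K.
Proof.
rewrite mulr_sumr; apply: eq_bigr => x _ /=.
by rewrite -mulrA [LHS]mulrA -(commr_sign a) -mulrA.
Qed.

Lemma wedge_basis j v K : wedge (basis_vec j) v K =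
  if j \in K then (-1) ^+ above j K * v (K :\ j) else 0.
Proof.
rewrite /wedge big_mkcond (bigD1 j) //= /basis_vec eqxx mulr1 big1 ?addr0 //.
by move=> x /negPf ->; rewrite !mulr0 if_same.
Qed.

Lemma wedges_rcons (I : Type) (phi : I -> 'I_m -> A) js j v :
  wedges phi (rcons js j) v = wedge (phi j) (wedges phi js v).
Proof. exact: foldl_rcons. Qed.

Lemma wedges_cat (I : Type) (phi : I -> 'I_m -> A) js ls v :
  wedges phi (js ++ ls) v = wedges phi ls (wedges phi js v).
Proof. exact: foldl_cat. Qed.

Lemma wedges_map (I I' : Type) (f : I -> I') (phi : I' -> 'I_m -> A) js v :
  wedges phi (map f js) v = wedges (fun j => phi (f j)) js v.
Proof. by elim: js v => //= j js IHjs v; rewrite IHjs. Qed.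

Lemma wedgesDr (I : Type) (phi : I -> 'I_m -> A) js v w K :
  wedges phi js (fun K => v K + w K) K = wedges phi js v K + wedges phi js w K.
Proof.
elim/last_ind: js K => // js j IHjs K; rewrite !wedges_rcons -wedgeDr.
by apply: wedge_eq.
Qed.

Lemma wedges_eq (I : eqType) (phi psi : I -> 'I_m -> A) js v K :
  (forall j x, j \in js -> x \in K -> phi j x = psi j x) ->
  wedges phi js v K = wedges psi js v K.
Proof.
elim/last_ind: js K => // js j IHjs K pp; rewrite !wedges_rcons.
apply: wedge_eq => x xK; first by apply: pp; rewrite // mem_rcons mem_head.
apply: IHjs => i y ijs; rewrite !inE => /andP[_ yK].
by apply: pp => //; rewrite mem_rcons inE ijs orbT.
Qed.

Lemma wedges_vac_size (I : Type) (phi : I -> 'I_m -> A) js K :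
  #|K| != size js -> wedges phi js vac K = 0.
Proof.
elim/last_ind: js K => [|js j IHjs] K; first by rewrite cards_eq0 /= /vac => /negPf ->.
rewrite wedges_rcons size_rcons => nK; apply: big1 => x xK.
rewrite IHjs ?mul0r ?mulr0 //; apply: contraNneq nK => <-.
by rewrite (cardsD1 x K) xK.
Qed.

Lemma aboveD1 x y K : x \in K -> above y K = ((y < x) + above y (K :\ x))%N.
Proof.
move=> xK; rewrite /above (cardsD1 x) !inE xK /=; congr addn.
by apply: eq_card => z; rewrite !inE; case: eqP.
Qed.

(** Removing [x] before [y] or after it changes the sign ([aboveD1]), so the two orders combine into
    one term per pair of rows. Anticommutation thus becomes a condition on pairs of rows. *)
Lemma wedge_wedge c d v K : wedge d (wedge c v) K =
  \sum_(x in K) \sum_(y in K | (x < y)%N)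
    (-1) ^+ (above x K + above y K) *
      (v (K :\ x :\ y) * (c y * d x - c x * d y)).
Proof.
transitivity (\sum_(x in K) (\sum_(y in K | (x < y)%N)
    (-1) ^+ (above x K + above y K) * (v (K :\ x :\ y) * (c y * d x))
  - \sum_(y in K | (y < x)%N)
    (-1) ^+ (above x K + above y K) * (v (K :\ x :\ y) * (c y * d x)))).
  apply: eq_bigr => x xK; rewrite /wedge mulr_suml mulr_sumr.
  rewrite (bigID (fun y : 'I_m => x < y)%N) /=; congr (_ + _).
    apply: eq_big => [y|y /andP[]].
      rewrite !inE; case: eqVneq => [->|]; first by rewrite ltnn !andbF.
      by [].
    rewrite !inE => /andP[_ yK] xy; rewrite (aboveD1 y xK).
    by rewrite ltnNge (ltnW xy) add0n exprD -!mulrA.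
  rewrite -sumrN; apply: eq_big => [y|y /andP[]].
    rewrite !inE -leqNgt leq_eqVlt -(inj_eq val_inj) /=.
    by case: ltngtP; rewrite ?andbF //= ?andbT.
  rewrite !inE => /andP[nyx yK]; rewrite -leqNgt leq_eqVlt.
  rewrite (inj_eq val_inj) (negPf nyx) /= => xy.
  by rewrite [in RHS](aboveD1 y xK) xy addnCA exprS mulN1r mulNr opprK exprD -!mulrA.
rewrite sumrB; under [X in _ - X]eq_bigr do rewrite big_mkcondr.
rewrite [X in _ - X]exchange_big /= -sumrB; apply: eq_bigr => x xK.
rewrite -[X in _ - X]big_mkcondr -sumrB; apply: eq_bigr => y /andP[yK xy].
rewrite addnC; have -> : K :\ y :\ x = K :\ x :\ y by rewrite finset.setDDl finset.setUC -finset.setDDl.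
by rewrite -!mulrBr addnC.
Qed.

(** * Anticommuting columns modulo a two-sided ideal *)

Section Ideal.
Variable J : A -> Prop.
Hypotheses (J0 : J 0) (JD : forall a b, J a -> J b -> J (a + b)).
Hypothesis JM : forall a b b', J b -> J (a * b * b').

Lemma idealMl a b : J b -> J (a * b).
Proof. by move=> /(JM a 1); rewrite mulr1. Qed.

Lemma idealMr a b : J a -> J (a * b).
Proof. by move=> /(JM 1 b); rewrite mul1r. Qed.

Lemma idealN a : J a -> J (- a).
Proof. by move=> /(idealMl (-1)); rewrite mulN1r. Qed.

Lemma idealB a b : J a -> J b -> J (a - b).
Proof. by move=> Ja Jb; apply: JD => //; apply: idealN. Qed.

Lemma ideal_sum (I : Type) (r : seq I) (P : pred I) (F : I -> A) :
  (forall i, P i -> J (F i)) -> J (\sum_(i <- r | P i) F i).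
Proof. by move=> JF; elim/big_ind: _. Qed.

Lemma ideal_trans b a b' : J (a - b) -> J (b - b') -> J (a - b').
Proof. by move=> ab bc; rewrite -(subrKA b); apply: JD. Qed.

Lemma wedge_ideal c v K : (forall K, J (v K)) -> J (wedge c v K).
Proof.
move=> Jv; apply: ideal_sum => x _; apply: idealMl; exact: idealMr.
Qed.

Lemma wedge_congr c d v w K :
  (forall x, x \in K -> J (c x - d x)) ->
  (forall x, x \in K -> J (v (K :\ x) - w (K :\ x))) ->
  J (wedge c v K - wedge d w K).
Proof.
move=> Jcd Jvw; rewrite -sumrB; apply: ideal_sum => x xK.
rewrite -mulrBr; apply: idealMl; apply: (@ideal_trans (w (K :\ x) * c x)).
  by rewrite -mulrBl; apply: idealMr; apply: Jvw.
by rewrite -mulrBr; apply: idealMl; apply: Jcd.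
Qed.

Lemma wedges_congr (I : eqType) (phi psi : I -> 'I_m -> A) js v K :
  (forall j x, j \in js -> x \in K -> J (phi j x - psi j x)) ->
  J (wedges phi js v K - wedges psi js v K).
Proof.
elim/last_ind: js K => [|js j IHjs] K pp; first by rewrite subrr.
rewrite !wedges_rcons.
apply: wedge_congr => x xK; first by apply: pp; rewrite // mem_rcons mem_head.
apply: IHjs => i y ijs; rewrite !inE => /andP[_ yK].
by apply: pp => //; rewrite mem_rcons inE ijs orbT.
Qed.

Lemma wedge_anticomm c d v K :
  (forall x y : 'I_m, (x < y)%N ->
     J (c y * d x + d y * c x - c x * d y - d x * c y)) ->
  J (wedge d (wedge c v) K + wedge c (wedge d v) K).
Proof.
move=> Jcd; rewrite !wedge_wedge -big_split; apply: ideal_sum => x _ /=.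
rewrite -big_split; apply: ideal_sum => y /andP[_ xy] /=.
rewrite -!mulrDr; apply: idealMl; apply: idealMl.
by rewrite addrACA addrA; apply: Jcd.
Qed.

Lemma wedge_sqr c v K :
  (forall x y : 'I_m, (x < y)%N -> J (c y * c x - c x * c y)) ->
  J (wedge c (wedge c v) K).
Proof.
move=> Jc; rewrite wedge_wedge; apply: ideal_sum => x _ /=.
apply: ideal_sum => y /andP[_ xy] /=.
by apply: idealMl; apply: idealMl; apply: Jc.
Qed.

Variables (phi : 'I_m -> 'I_m -> A).
Hypothesis phi_anticomm : forall j k v K,
  J (wedge (phi k) (wedge (phi j) v) K + wedge (phi j) (wedge (phi k) v) K).
Hypothesis phi_sqr : forall j v K, J (wedge (phi j) (wedge (phi j) v) K).

(** The factor [phi j] is moved past the later factors, up to sign, until it meets its other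
    copy. *)
Lemma wedge_wedges_ideal j js v K :
  j \in js -> J (wedge (phi j) (wedges phi js v) K).
Proof.
elim/last_ind: js K => // js i IHjs K.
rewrite wedges_rcons mem_rcons inE => /predU1P[->|/IHjs{}IHjs].
  exact: phi_sqr.
rewrite -[wedge _ _ _](addrK
  (wedge (phi i) (wedge (phi j) (wedges phi js v)) K)).
by apply: idealB; [exact: phi_anticomm | apply: wedge_ideal].
Qed.

(** The coefficients [y] stand on the right of the column entries, where [wedge] lets them be
    factored out; what is left is [phi k] applied after the other columns, and it can be moved back
    to [v], which it kills. *)
Lemma wedges_column_ops (L : seq 'I_m) (y : 'I_m -> 'I_m -> A) v js K :
  (forall k K, k \in L -> J (wedge (phi k) v K)) ->
  J (wedges phi js v K -
     wedges (fun j x => phi j x - \sum_(k <- L) phi k x * y k j) js v K).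
Proof.
move=> Lv; elim/last_ind: js K => [|js j IHjs] K; first by rewrite subrr.
rewrite !wedges_rcons.
(* The last column is modified while the earlier ones are still the original [phi], since only these
   are known to anticommute with [phi k]. *)
apply: (@ideal_trans (wedge (fun x => phi j x - \sum_(k <- L) phi k x * y k j)
  (wedges phi js v) K)); last first.
  by apply: wedge_congr => [x _|x _]; [rewrite subrr | apply: IHjs].
rewrite wedgeDl wedgeNl opprD addrA subrr add0r opprK.
have -> : wedge (fun x => \sum_(k <- L) phi k x * y k j) (wedges phi js v) K =
    \sum_(k <- L) wedge (phi k) (wedges phi js v) K * y k j.
  rewrite /wedge; under [RHS]eq_bigr do rewrite mulr_suml.
  rewrite exchange_big; apply: eq_bigr => x _; rewrite mulr_sumr mulr_sumr.
  by apply: eq_bigr => k _; rewrite !mulrA.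
rewrite big_seq; apply: ideal_sum => k kL; apply: idealMr.
elim/last_ind: {IHjs} js K => [|js i IHjs] K; first exact: Lv.
rewrite wedges_rcons -[wedge _ _ _](addrK
  (wedge (phi i) (wedge (phi k) (wedges phi js v)) K)).
by apply: idealB; [exact: phi_anticomm | apply: wedge_ideal].
Qed.

End Ideal.

(** * Expansion over principal minors and over permutations *)

(** The entries 0 and 1 are central, so this is [wedge_anticomm] for the zero ideal. *)
Lemma wedge_basis_anticomm c j v K :
  wedge c (wedge (basis_vec j) v) K = - wedge (basis_vec j) (wedge c v) K.
Proof.
apply/eqP; rewrite -addr_eq0; apply/eqP.
apply: (@wedge_anticomm (fun a => a = 0)) => //.
- by move=> _ _ -> ->; rewrite addr0.
- by move=> a _ b ->; rewrite mulr0 mul0r.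
move=> x y _; rewrite /basis_vec.
by case: (x == j); case: (y == j);
  rewrite /= ?(mulr1n, mulr0n, mul1r, mulr1, mul0r, mulr0, add0r, addr0, subr0, addrK) ?(subrr, oppr0).
Qed.

Lemma wedges_basis_anticomm (I : Type) (phi : I -> 'I_m -> A) js j v K :
  wedges phi js (wedge (basis_vec j) v) K =
  (-1) ^+ size js * wedge (basis_vec j) (wedges phi js v) K.
Proof.
elim/last_ind: js K => [|js i IHjs] K; first by rewrite mul1r.
rewrite !wedges_rcons size_rcons.
transitivity (wedge (phi i)
    (fun K => (-1) ^+ size js * wedge (basis_vec j) (wedges phi js v) K) K).
  by apply: wedge_eq.
by rewrite wedgeZr wedge_basis_anticomm exprS mulN1r mulrN mulNr.
Qed.

(* Interpolates between - C, for D empty, and 1 - C. *)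
Definition partial_one_minus (C : 'I_m -> 'I_m -> A) D (j x : 'I_m) : A :=
  (if j \in D then basis_vec j x else 0) - C j x.

Lemma wedges_partial_one_minus C D K j : j \in K -> j \in D ->
  wedges (partial_one_minus C D) (enum K) vac K =
  wedges (partial_one_minus C (D :\ j)) (enum (K :\ j)) vac (K :\ j) +
  wedges (partial_one_minus C (D :\ j)) (enum K) vac K.
Proof.
move=> jK jD; have [l1 [l2 [-> -> /andP[j1 j2] sl2]]] := enum_setD1_split jK.
set phi := partial_one_minus C D; set psi := partial_one_minus C (D :\ j).
have E l v K' : j \notin l -> wedges phi l v K' = wedges psi l v K'.
  move=> jl; apply: wedges_eq => i x il _.
  rewrite /phi /psi /partial_one_minus !inE; case: eqVneq => // ij.
  by rewrite -ij il in jl.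
rewrite !wedges_cat /= E //.
have -> : wedge (phi j) (wedges phi l1 vac) =
    fun K => wedge (basis_vec j) (wedges psi l1 vac) K +
             wedge (psi j) (wedges psi l1 vac) K.
  apply/funext => K'; rewrite -wedgeDl; apply: wedge_eq => x _; last exact: E.
  by rewrite /phi /psi /partial_one_minus jD !inE eqxx sub0r.
rewrite wedgesDr wedges_basis_anticomm wedge_basis jK sl2 mulrA -expr2.
by rewrite sqrr_sign mul1r.
Qed.

(** Source of the sign [(-1) ^+ #|J|] in the expansion of det(1 - C). *)
Lemma wedgesNl (I : Type) (phi : I -> 'I_m -> A) js v K :
  wedges (fun j x => - phi j x) js v K = (-1) ^+ size js * wedges phi js v K.
Proof.
elim/last_ind: js K => [|js j IHjs] K; first by rewrite mul1r.
rewrite !wedges_rcons size_rcons exprS mulN1r mulNr -wedgeZr wedgeNl.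
by congr (- _); apply: wedge_eq.
Qed.

(** Each column is expanded as basis vector minus column of [C]. A basis vector [e_j] deletes row
    and column [j], and its two signs, from moving it to the end and from [wedge], cancel
    ([wedges_partial_one_minus]). *)
Lemma wedges_one_minus (C : 'I_m -> 'I_m -> A) (H : {set 'I_m}) :
  wedges (fun j x => basis_vec j x - C j x) (enum H) vac H =
  \sum_(J : {set 'I_m} | J \subset H)
    (-1) ^+ #|J| * wedges C (enum J) vac J.
Proof.
(* Only the columns in [D] carry a basis vector, so the labels of [K] outside [D] are never deleted;
   [D = K] is the claim, and the induction is on the size of [D]. *)
suff E K D : D \subset K ->
    wedges (partial_one_minus C D) (enum K) vac K =
    \sum_(J : {set 'I_m} | (K :\: D \subset J) && (J \subset K))
      (-1) ^+ #|J| * wedges C (enum J) vac J.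
  have eH (J : {set 'I_m}) : (J \subset H) = (H :\: H \subset J) && (J \subset H).
    by rewrite finset.setDv finset.sub0set.
  rewrite (eq_bigl _ _ eH).
  rewrite -E //; apply: wedges_eq => j x.
  by rewrite /partial_one_minus mem_enum => ->.
move: {2}#|D| (eqP (eqxx #|D|)) => d; elim: d => [|d IHd] in K D *.
  move=> /eqP; rewrite cards_eq0 => /eqP -> _; rewrite (big_pred1 K); last first.
    by move=> J; rewrite /= finset.setD0 finset.eqEsubset andbC.
  by rewrite cardE -wedgesNl; apply: wedges_eq => j x _ _;
    rewrite /partial_one_minus inE sub0r.
move=> sD DK; have [j jD] : exists j, j \in D by apply/card_gt0P; rewrite sD.
have jK : j \in K by apply: (fintype.subsetP DK).
have sDj : #|D :\ j| = d by move: sD; rewrite (cardsD1 j) jD => -[].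
rewrite (wedges_partial_one_minus _ jK jD) !IHd //; last 2 first.
- by apply: fintype.subset_trans DK; apply: finset.subsetDl.
- exact: finset.setSD.
rewrite [RHS](bigID (fun J : {set 'I_m} => j \in J)) addrC /=; congr (_ + _).
  apply: eq_bigl => J; rewrite finset.setDDr finset.subUset.
  by rewrite (finset.setIidPr _) ?finset.sub1set // andbAC.
have -> : K :\ j :\: (D :\ j) = K :\: D.
  by apply/setP => x; rewrite !inE; case: eqVneq => // ->; rewrite jD.
by apply: eq_bigl => J; rewrite finset.subsetD1 andbA.
Qed.

(** [t] lists the rows chosen by the successive columns; a last row [x] creates [above x K] new
    inversions, the exponent in [wedge]. *)
Lemma wedges_permutations (I : Type) (phi : I -> 'I_m -> A) js K :
  #|K| = size js ->
  wedges phi js vac K = \sum_(t <- permutations (enum K))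
    (-1) ^+ inv_word t * \prod_(p <- zip js t) phi p.1 p.2.
Proof.
elim/last_ind: js K => [|js j IHjs] K.
  move/eqP; rewrite cards_eq0 => /eqP ->.
  rewrite /= /vac eqxx enum_set0 /= big_seq1 big_nil mulr1.
  rewrite (_ : inv_word _ = 0%N) // /inv_word.
  by apply: eq_card0 => -[[]].
rewrite size_rcons wedges_rcons => sK.
(* The arrangements of [K] are grouped by their last letter. *)
rewrite (perm_big [seq rcons t x | x <- enum K, t <- permutations (enum (K :\ x))]).
  rewrite big_allpairs_dep big_enum; apply: eq_bigr => x xK.
  have sKx : #|K :\ x| = size js by move: sK; rewrite (cardsD1 x) xK => -[].
  rewrite IHjs // mulr_suml mulr_sumr [LHS]big_seq [RHS]big_seq; apply: eq_bigr => t.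
  rewrite mem_permutations => tK.
  have st : size t = size js by rewrite (perm_size tK) -cardE.
  rewrite zip_rcons // inv_word_rcons -cats1 big_cat big_seq1 /=.
  have -> : count (fun y : 'I_m => x < y)%N t = above x K.
    rewrite (seq.permP tK) -size_filter /above cardE; apply/perm_size/uniq_perm.
    - by rewrite filter_uniq // enum_uniq.
    - exact: enum_uniq.
    move=> y; rewrite mem_filter !mem_enum !inE andbC.
    by case: eqVneq => // ->; rewrite ltnn !andbF.
  by rewrite addnC exprD !mulrA.
apply: uniq_perm; first exact: permutations_uniq.
  apply: allpairs_uniq_dep.
  - exact: enum_uniq.
  - by move=> x _; apply: permutations_uniq.
  by move=> [x t] [x' t'] _ _ /= /rcons_inj[-> ->].
move=> t; rewrite mem_permutations; apply/idP/allpairsPdep => [|[x [t' [xK]]]].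
  case/lastP: t => [/perm_size|t x tK]; first by rewrite -cardE sK.
  have xK : x \in K by rewrite -mem_enum -(perm_mem tK) mem_rcons mem_head.
  exists x, t; split=> //; first by rewrite mem_enum.
  rewrite mem_permutations; have [l1 [l2 [EK -> _ _]]] := enum_setD1_split xK.
  move: tK; rewrite EK perm_rcons perm_sym -(cat1s x l2) perm_catCA /=.
  by rewrite perm_cons perm_sym.
rewrite mem_enum in xK; have [l1 [l2 [EK E _ _]]] := enum_setD1_split xK.
rewrite mem_permutations E => tK ->.
by rewrite EK perm_rcons perm_sym -(cat1s x l2) perm_catCA /= perm_cons perm_sym.
Qed.

Lemma wedges_Sym (c : 'I_m -> 'I_m -> A) (J : {set 'I_m}) :
  wedges (fun j x => c x j) (enum J) vac J = \sum_(s in Sym J)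
    (-1) ^+ inv_word [seq s j | j <- enum J] * \prod_(j <- enum J) c (s j) j.
Proof.
rewrite wedges_permutations -?cardE //.
rewrite (perm_big [seq [seq (s : {perm 'I_m}) j | j <- enum J] | s <- enum (Sym J)]).
  rewrite big_map big_enum; apply: eq_bigr => s _; congr (_ * _).
  by elim: (enum J) => [|j js IHjs]; rewrite /= ?big_nil // !big_cons IHjs.
rewrite perm_sym; apply: uniq_perm.
- rewrite map_inj_in_uniq ?enum_uniq // => s t.
  rewrite !mem_enum /Sym !inE => sJ tJ st; apply/permP => j.
  case: (boolP (j \in J)) => jJ; last by rewrite !(out_perm _ jJ).
  by move/eq_in_map: st; apply; rewrite mem_enum.
- exact: permutations_uniq.
(* Surjectivity by counting: the map is injective and both lists have [#|J|] factorial elements. *)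
have [] := @uniq_min_size _ [seq [seq (s : {perm 'I_m}) j | j <- enum J] | s <- enum (Sym J)] (permutations (enum J)); last by [].
- rewrite map_inj_in_uniq ?enum_uniq // => s t.
  rewrite !mem_enum /Sym !inE => sJ tJ st; apply/permP => j.
  case: (boolP (j \in J)) => jJ; last by rewrite !(out_perm _ jJ).
  by move/eq_in_map: st; apply; rewrite mem_enum.
- move=> _ /mapP[s + ->]; rewrite mem_enum inE => sJ; rewrite mem_permutations.
  apply: uniq_perm; rewrite ?enum_uniq ?map_inj_uniq ?enum_uniq //; first exact: perm_inj.
  move=> x; rewrite mem_enum; apply/mapP/idP => [[y + ->]|xJ].
    by rewrite mem_enum (perm_closed _ sJ).
  exists (s^-1%g x); last by rewrite permKV.
  by rewrite mem_enum -(perm_closed _ sJ) permKV.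
by rewrite size_permutations ?enum_uniq // size_map -!cardE card_Sym.
Qed.

End Grassmann.

(** * Increasing relabellings of the rows *)

Section WedgeImset.
Set Implicit Arguments.
Unset Strict Implicit.
Import GRing.Theory.
Variables (N m : nat) (A : nzRingType) (f : 'I_N -> 'I_m).
Hypothesis f_mono : forall x y, (f x < f y)%N = (x < y)%N.
Implicit Types K : {set 'I_N}.

Lemma ord_mono_inj : injective f.
Proof.
move=> x y /(congr1 val) fxy; apply/val_inj/eqP; have := f_mono x y.
by have := f_mono y x; rewrite fxy ltnn /=; case: ltngtP.
Qed.

Lemma wedge_imset (c : 'I_m -> A) v K :
  wedge c v (f @: K)%SET = wedge (fun x => c (f x)) (fun K => v (f @: K)%SET) K.
Proof.
rewrite /wedge big_imset /=; last by move=> x y _ _; apply: ord_mono_inj.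
apply: eq_bigr => x xK; congr (_ ^+ _ * (v _ * _)).
  rewrite /above -(card_imset _ ord_mono_inj); apply: eq_card => y.
  rewrite !inE; apply/andP/imsetP => [[/imsetP[z zK ->]]|[z + ->]].
    by rewrite f_mono => xz; exists z; rewrite // inE zK.
  by rewrite inE f_mono => /andP[zK ->]; rewrite imset_f.
apply/setP => y; rewrite !inE; apply/andP/imsetP => [[yx /imsetP[z zK zy]]|[z + ->]].
  by exists z; rewrite // !inE zK andbT; apply: contraNneq yx => <-; rewrite zy.
by rewrite !inE => /andP[zx zK]; rewrite (inj_eq ord_mono_inj) zx imset_f.
Qed.

Lemma wedges_vac_imset (I : Type) (phi : I -> 'I_m -> A) js K :
  wedges phi js (vac A) (f @: K)%SET =
  wedges (fun j x => phi j (f x)) js (vac A) K.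
Proof.
elim/last_ind: js K => [|js j IHjs] K; first by rewrite /= /vac imset_eq0.
by rewrite !wedges_rcons wedge_imset; apply: wedge_eq.
Qed.

End WedgeImset.

(** * The Schur complement formula at q = 1 *)

Section ManinSchur.
Set Implicit Arguments.
Unset Strict Implicit.
Import GRing.Theory.
Variables (m n : nat) (A : nzRingType) (a : 'I_m -> 'I_m -> A).
Variable J : A -> Prop.
Hypotheses (J0 : J 0) (JD : forall u v, J u -> J v -> J (u + v)).
Hypothesis JM : forall u v w, J v -> J (u * v * w).
Hypothesis Jcol : forall i j k : 'I_m, (i < j)%N ->
  J (a j k * a i k - a i k * a j k).
Hypothesis Jcross : forall i j k l : 'I_m, (i < j)%N -> (k < l)%N ->
  J ((a i k * a j l - a j k * a i l) - (a j l * a i k - a i l * a j k)).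
Implicit Types K : {set 'I_m}.

Local Notation L := [set x : 'I_m | (x < n)%N]%SET.
Local Notation H := [set x : 'I_m | (n <= x)%N]%SET.

Definition one_minus_col (j x : 'I_m) : A := basis_vec A j x - a x j.
Local Notation phi := one_minus_col.

Lemma wedge_one_minus_col j (v : {set 'I_m} -> A) :
  wedge (phi j) v =
  fun K => wedge (basis_vec A j) v K + - 1 * wedge (fun x => a x j) v K.
Proof. by apply/funext => K; rewrite mulN1r -wedgeNl -wedgeDl. Qed.

(** The combination required by [wedge_anticomm] is, up to sign, the cross relator for distinct
    columns, and twice the column relator for [j = k]. *)
Lemma wedge_col_anticomm j k v K :
  J (wedge (fun x => a x k) (wedge (fun x => a x j) v) K +
     wedge (fun x => a x j) (wedge (fun x => a x k) v) K).
Proof.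
have E (p q r s : A) : - ((p - q) - (r - s)) = q + r - p - s.
  by rewrite !opprB addrACA (addrC r) (addrC (- s)) addrA.
apply: wedge_anticomm => // x y xy; case: (ltngtP j k) => [jk|kj|/val_inj<-].
- by have := idealN JM (Jcross xy jk); rewrite E.
- have := idealN JM (Jcross xy kj); rewrite E.
  by rewrite addrAC (addrC (a y k * a x j)).
by have := JD (Jcol j xy) (Jcol j xy); rewrite addrACA addrA.
Qed.

Lemma wedge_basis_basis j v K :
  wedge (basis_vec A j) (wedge (basis_vec A j) v) K = 0.
Proof.
apply: (@wedge_sqr _ _ (fun u => u = 0)) => //.
- by move=> _ _ -> ->; rewrite addr0.
- by move=> u _ w ->; rewrite mulr0 mul0r.
by move=> x y _; rewrite /basis_vec -!natrM mulnC subrr.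
Qed.

(** The mixed terms are grouped into an expression antisymmetric in [j] and [k]: it cancels in the
    anticommutator and vanishes for [j = k]. *)
Lemma wedge2_one_minus_col j k v K :
  wedge (phi k) (wedge (phi j) v) K =
    wedge (basis_vec A k) (wedge (basis_vec A j) v) K
  + wedge (fun x => a x k) (wedge (fun x => a x j) v) K
  + (wedge (basis_vec A j) (wedge (fun x => a x k) v) K
     - wedge (basis_vec A k) (wedge (fun x => a x j) v) K).
Proof.
rewrite !wedge_one_minus_col !wedgeDr !wedgeZr.
rewrite (wedge_basis_anticomm (fun x => a x k)) !mulN1r opprD !opprK.
set B := wedge _ _ K; set W := wedge _ _ K; set U := wedge _ _ K.
by rewrite (addrC U) addrACA (addrC (- W)).
Qed.

Lemma wedge_one_minus_col_anticomm j k v K :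
  J (wedge (phi k) (wedge (phi j) v) K + wedge (phi j) (wedge (phi k) v) K).
Proof.
rewrite !wedge2_one_minus_col addrACA.
have -> u w : (u - w) + (w - u) = 0 :> A by rewrite -opprB addNr.
rewrite addr0 addrACA wedge_basis_anticomm addNr add0r.
exact: wedge_col_anticomm.
Qed.

(** Anticommutation with [k = j] would give only twice the square, and 2 may fail to be invertible;
    the column relators give the square itself. *)
Lemma wedge_one_minus_col_sqr j v K : J (wedge (phi j) (wedge (phi j) v) K).
Proof.
rewrite wedge2_one_minus_col subrr addr0 wedge_basis_basis add0r.
by apply: wedge_sqr => // x y xy; apply: Jcol.
Qed.

(** Block triangular determinants: the new columns vanish on [L], so they can only use rows of [K],
    and [v] must use up all of [L]. *)
Lemma wedges_block (psi : 'I_m -> 'I_m -> A) js v K :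
  (forall j x, j \in js -> x \in L -> psi j x = 0) ->
  (forall K, K \subset H -> v (L :|: K) = v L * (vac A) K) ->
  K \subset H ->
  wedges psi js v (L :|: K) = v L * wedges psi js (vac A) K.
Proof.
move=> psi0 vL; elim/last_ind: js K psi0 => [|js j IHjs] K psi0 KH; first exact: vL.
rewrite !wedges_rcons /wedge (bigID [in L]) /= big1 ?add0r; last first.
  by move=> x /andP[_ xL]; rewrite psi0 ?mulr0 // mem_rcons mem_head.
rewrite mulr_sumr; apply: eq_big => [x|x].
  rewrite !inE; case: (boolP (x \in K)) => [/(fintype.subsetP KH)|_].
    by rewrite inE orbT /= -leqNgt.
  by rewrite orbF andbN.
rewrite !inE => /andP[xLK xL]; have xK : x \in K by rewrite (negPf xL) in xLK.
have -> : (L :|: K) :\ x = L :|: (K :\ x).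
  by apply/setP => y; rewrite !inE; case: eqVneq => // ->; rewrite (negPf xL).
rewrite IHjs; last 2 first.
- by move=> i y ijs; apply: psi0; rewrite mem_rcons inE ijs orbT.
- by apply: fintype.subset_trans KH; apply: finset.subsetDl.
(* The labels in [L] lie below [x], so they do not change the sign. *)
have -> : above x (L :|: K) = above x K.
  apply: eq_card => y; rewrite !inE; case: (ltnP x y) => xy; rewrite ?andbF //.
  rewrite !andbT; case: ltnP => //= yn; move: xL.
  by rewrite (ltn_trans xy yn).
by rewrite -[v L * _ * _]mulrA [LHS]mulrA -(commr_sign (v L)) -mulrA.
Qed.

Definition corner_det : A := wedges phi (enum L) (vac A) L.

Lemma wedges_L_vac K :
  K \subset H -> wedges phi (enum L) (vac A) (L :|: K) = corner_det * (vac A) K.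
Proof.
move=> KH; rewrite /vac; case: eqVneq => [->|K0].
  by rewrite finset.setU0 mulr1.
rewrite mulr0 wedges_vac_size // -cardE cardsU (_ : L :&: K = finset.set0).
  by rewrite cards0 subn0 -[X in _ != X]addn0 eqn_add2l cards_eq0.
apply/setP => x; rewrite !inE; apply/negP => /andP[xn /(fintype.subsetP KH)].
by rewrite inE leqNgt xn.
Qed.

Variable y : 'I_m -> 'I_m -> A.

(** Column [j] of the Schur complement of the corner [1 - A_0], the inverse of the corner entering
    only through the solution [y]. *)
Definition schur (j x : 'I_m) : A :=
  phi j x - \sum_(k <- enum L) phi k x * y k j.

Hypothesis schur0 : forall j x : 'I_m, (n <= j)%N -> (x < n)%N -> schur j x = 0.

Lemma wedges_schur js K : {subset js <= H} -> K \subset H ->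
  J (wedges phi js (wedges phi (enum L) (vac A)) (L :|: K)
     - corner_det * wedges schur js (vac A) K).
Proof.
move=> jsH KH.
have -> : corner_det * wedges schur js (vac A) K =
    wedges schur js (wedges phi (enum L) (vac A)) (L :|: K).
  rewrite wedges_block // => [j x /jsH|K' K'H]; last by rewrite wedges_L_vac.
  by rewrite !inE; apply: schur0.
apply: (wedges_column_ops J0 JD JM wedge_one_minus_col_anticomm) => k K' kL.
exact: (wedge_wedges_ideal J0 JD JM wedge_one_minus_col_anticomm wedge_one_minus_col_sqr).
Qed.

Lemma enum_setT_split : enum [set: 'I_m]%SET = enum L ++ enum H.
Proof.
have trl : transitive (fun x y : 'I_m => (x < y)%N).
  by move=> x z w; apply: ltn_trans.
apply: sorted_ord_inj; first exact: sorted_enum_set.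
  rewrite (sorted_pairwise trl) pairwise_cat -!(sorted_pairwise trl).
  rewrite !sorted_enum_set !andbT; apply/allrelP => x z.
  by rewrite !mem_enum !inE => xn /(leq_trans xn).
by move=> x; rewrite mem_cat !mem_enum !inE; case: ltnP.
Qed.

Lemma det_schur :
  J (wedges phi (enum [set: 'I_m]%SET) (vac A) [set: 'I_m]%SET
     - corner_det * wedges schur (enum H) (vac A) H).
Proof.
have -> : [set: 'I_m]%SET = L :|: H by apply/setP => x; rewrite !inE; case: ltnP.
have -> : L :|: H = [set: 'I_m]%SET by apply/setP => x; rewrite !inE; case: ltnP.
rewrite {1}enum_setT_split wedges_cat.
have -> : [set: 'I_m]%SET = L :|: H by apply/setP => x; rewrite !inE; case: ltnP.
by apply: wedges_schur => // x; rewrite mem_enum.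
Qed.

Definition bordered_det (i j : 'I_m) : A :=
  wedge (fun x => - a x j) (wedges phi (enum L) (vac A)) (i |: L).

(** The bordering column is [phi j] minus the basis vector [e_j]. The first term is [wedges_schur]
    for one column and one row; the second contributes [corner_det] when [i = j] and 0 otherwise. *)
Lemma bordered_schur (i j : 'I_m) : (n <= i)%N -> (n <= j)%N ->
  J (bordered_det i j - corner_det * (schur j i - basis_vec A j i)).
Proof.
move=> ni nj; rewrite /bordered_det finset.setUC.
have iH : [set i]%SET \subset H by rewrite finset.sub1set inE.
have -> : (fun x => - a x j) = (fun x => phi j x + - basis_vec A j x).
  by apply/funext => x; rewrite addrAC subrr add0r.
rewrite wedgeDl wedgeNl wedge_basis.
have jsH : {subset [:: j] <= H} by move=> x; rewrite !inE => /eqP ->.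
have := wedges_schur jsH iH; rewrite /= /wedge big_set1 /=.
have -> : above i [set i]%SET = 0%N.
  by apply: eq_card0 => x; rewrite !inE; case: eqVneq => // ->; rewrite ltnn.
rewrite mul1r finset.setDv /vac eqxx mul1r => JS.
have -> : (if j \in L :|: [set i]%SET then (-1) ^+ above j (L :|: [set i]%SET) *
    wedges phi (enum L) (vac A) ((L :|: [set i]%SET) :\ j) else 0) =
    corner_det * basis_vec A j i.
  rewrite !inE ltnNge nj /=; case: eqVneq => [ji|ji]; last first.
    by rewrite /basis_vec eq_sym (negPf ji) mulr0.
  have -> : (L :|: [set i]%SET) :\ j = L.
    apply/setP => x; rewrite !inE ji; case: eqVneq => [->|_]; last by rewrite orbF.
    by rewrite ltnNge ni.
  have -> : above j (L :|: [set i]%SET) = 0%N.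
    apply: eq_card0 => x; rewrite !inE ji; case: eqVneq => [->|_]; first by rewrite ltnn andbF.
    by rewrite orbF; apply/negP => /andP[xn /(ltn_trans)/(_ xn)]; rewrite ltnNge ni.
  by rewrite /basis_vec ji eqxx mul1r mulr1.
by rewrite mulrBr opprB addrA subrK.
Qed.

(** Multiplying by [X'] turns [det_schur] into the determinant of the Schur complement and
    [bordered_schur] into the statement that this complement is 1 - C; [wedges_one_minus] then
    expands it. *)
Lemma manin_schur (X' : A) : X' * corner_det = 1 ->
  J (X' * wedges phi (enum [set: 'I_m]%SET) (vac A) [set: 'I_m]%SET
     - \sum_(K : {set 'I_m} | K \subset H) (-1) ^+ #|K| *
         wedges (fun j x => - (X' * bordered_det x j)) (enum K) (vac A) K).
Proof.
move=> X'X; rewrite -wedges_one_minus.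
apply: (ideal_trans JD (b := wedges schur (enum H) (vac A) H)).
  rewrite -[X in _ - X]mul1r -X'X -mulrA -mulrBr; apply: (idealMl JM).
  exact: det_schur.
apply: (wedges_congr J0 JD JM) => j x; rewrite mem_enum !inE => nj nx.
rewrite opprK; have := idealMl JM (- X') (bordered_schur nx nj).
by rewrite mulrBr !mulNr opprK mulrA X'X mul1r addrC opprD addrA.
Qed.

End ManinSchur.

(** * The determinants at q = 1 as elements of the exterior algebra *)

Section SeriesDeterminants.
Set Implicit Arguments.
Unset Strict Implicit.
Import GRing.Theory.
Variables (K : fieldType) (m : nat).
Local Notation A := (ncfps K ('I_m * 'I_m)%type).
Local Notation letter := (@letter K m).

Lemma letterME i j (f : A) w : (letter i j * f) w =
  if w is p :: w' then (p == (i, j))%:R * f w' else 0.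
Proof.
rewrite ncfpsM /letter /ncfps_var; case: w => [|p w] /=.
  by rewrite big_ord1 /= mul0r.
rewrite big_ord_recl /= mul0r add0r big_ord_recl /= take0 drop0.
rewrite eqseq_cons andbT big1 ?addr0 // => k _.
by case: w k => [[[]]|q w k] //=; rewrite eqseq_cons andbF mul0r.
Qed.

(* The coefficients of the solution of (1 - A_0) y = - a_{*j}. *)
Fixpoint schur_sol (n : nat) (j : 'I_m) (w : seq ('I_m * 'I_m)) (x : 'I_m) : K :=
  if w is p :: w' then
    if p.1 == x then
      if (p.2 < n)%N then schur_sol n j w' p.2 else - ((p.2 == j) && nilp w')%:R
    else 0
  else 0.

(** The word of a path from [x] to [j] through labels below [n] has coefficient -1 and every other
    word 0; the equation splits off the first letter. *)
Lemma schur_solE (n : nat) (x j : 'I_m) : (n <= j)%N ->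
  ((schur_sol n j)^~ x : A) = - letter x j +
    \sum_(k <- enum [set k : 'I_m | (k < n)%N]%SET) letter x k * (schur_sol n j)^~ k.
Proof.
move=> nj; apply/funext => w; rewrite ncfpsD ncfpsN ncfps_sumE.
under eq_bigr do rewrite letterME.
rewrite big_enum /=; case: w => [|[p1 p2] w].
  by rewrite big1 // /letter /Defs.letter /ncfps_var /= oppr0 addr0.
rewrite /= /Defs.letter /ncfps_var eqseq_cons xpair_eqE.
under eq_bigr do rewrite xpair_eqE.
case: (p1 == x) => /=; last by rewrite oppr0 add0r big1 // => k _; rewrite mul0r.
case: ifP => p2n.
  rewrite (bigD1 p2) ?inE //= eqxx mul1r big1 ?addr0; last first.
    by move=> k /andP[_ kp]; rewrite eq_sym (negPf kp) mul0r.
  case: eqVneq => [E|_]; first by rewrite E ltnNge nj in p2n.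
  by rewrite oppr0 add0r.
rewrite big1 ?addr0 //; first by case: w.
move=> k; rewrite inE => kn; case: eqVneq => [E|_]; last by rewrite mul0r.
by rewrite E kn in p2n.
Qed.

Lemma schur_letter0 (n : nat) (j x : 'I_m) : (n <= j)%N -> (x < n)%N ->
  schur n letter (fun k j => (schur_sol n j)^~ k : A) j x = 0.
Proof.
move=> nj xn; rewrite /schur /one_minus_col.
rewrite /basis_vec; case: eqVneq => [E|_]; first by rewrite E ltnNge nj in xn.
under eq_bigr do rewrite mulrBl.
rewrite sumrB big_enum /= (bigD1 x) ?inE //= eqxx mul1r big1 ?addr0; last first.
  by move=> k /andP[_ kx]; rewrite eq_sym (negPf kx) mul0r.
by rewrite (schur_solE x nj) addrK sub0r subrr.
Qed.

(** The determinant at q = 1: [qdet q B] is [weigh_words q (mxdet B)]. *)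
Definition mxdet (N : nat) (B : 'M[A]_N) : A := \sum_(s : 'S_N)
  (-1) ^+ inv_word [seq s r | r <- enum 'I_N] * \prod_(r < N) B (s r) r.

Lemma mxdet_wedges (N : nat) (B : 'M[A]_N) : mxdet B =
  wedges (fun r x => B x r) (enum [set: 'I_N]%SET) (vac A) [set: 'I_N]%SET.
Proof.
rewrite wedges_Sym /mxdet; apply: eq_big => [s|s _].
  by rewrite inE; apply/esym/fintype.subsetP => x; rewrite inE.
rewrite enum_setT -enumT; congr (_ * _).
by rewrite [index_enum _]unlock enumT.
Qed.

Lemma mxdet_wedges_imset (N : nat) (B : 'M[A]_N) (f : 'I_N -> 'I_m)
    (psi : 'I_N -> 'I_m -> A) :
  (forall x y, (f x < f y)%N = (x < y)%N) ->
  (forall x r, B x r = psi r (f x)) ->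
  mxdet B = wedges psi (enum [set: 'I_N]%SET) (vac A) (f @: [set: 'I_N])%SET.
Proof.
move=> f_mono BE; rewrite mxdet_wedges wedges_vac_imset //.
by apply: wedges_eq => r x _ _; apply: BE.
Qed.

Lemma mxdet_amx : mxdet (1%:M - amx K m) =
  wedges (one_minus_col letter) (enum [set: 'I_m]%SET) (vac A) [set: 'I_m]%SET.
Proof. by rewrite mxdet_wedges; apply: wedges_eq => r x _ _; rewrite !mxE. Qed.

Lemma enum_setTE (T : finType) : enum [set: T]%SET = enum T.
Proof. by rewrite enum_setT enumT. Qed.

Lemma enum_ord_add1 n : enum 'I_(n + 1) =
  rcons [seq lshift 1 k | k <- enum 'I_n] (rshift n ord0).
Proof.
have E N : [seq nat_of_ord i | i <- enum 'I_N] = iota 0 N := val_enum_ord N.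
apply: (inj_map (@ord_inj _)); rewrite map_rcons -map_comp E iotaD -E -cats1.
by rewrite /= addn0.
Qed.

Section Corner.
Variables (n : nat) (ltnm : (n < m)%N).
Local Notation emb := (widen_ord (ltnW ltnm)).
Local Notation L := [set x : 'I_m | (x < n)%N]%SET.

Lemma imset_emb : (emb @: [set: 'I_n])%SET = L.
Proof.
apply/setP => x; rewrite inE; apply/imsetP/idP => [[k _ ->]|xn] /=.
  exact: ltn_ord.
by exists (Ordinal xn); rewrite ?inE //; apply: val_inj.
Qed.

Lemma enum_emb : [seq emb k | k <- enum [set: 'I_n]%SET] = enum L.
Proof.
apply: sorted_ord_inj; last 1 first.
- move=> x; rewrite mem_enum -imset_emb; apply/mapP/imsetP => -[k];
  by exists k; rewrite // ?mem_enum // -mem_enum.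
- by rewrite sorted_map; apply: sorted_enum_set.
exact: sorted_enum_set.
Qed.

Lemma mxdet_amx0 : mxdet (1%:M - amx0 K ltnm) = corner_det n letter.
Proof.
rewrite (@mxdet_wedges_imset _ _ emb (fun r => one_minus_col letter (emb r))) //.
  by rewrite -(wedges_map emb) enum_emb imset_emb.
by move=> x r; rewrite !mxE /one_minus_col /basis_vec.
Qed.

Lemma mxdet_bordered (i j : 'I_m) : (n <= i)%N ->
  mxdet (bordered_mx K ltnm i j) = bordered_det n letter i j.
Proof.
(* [f] gives the row labels, increasing because [n <= i], and [psi] the columns extended to all
   labels. *)
move=> ni; pose f (r : 'I_(n + 1)) := match fintype.split r with
  inl k => emb k | inr _ => i end.
pose psi (r : 'I_(n + 1)) : 'I_m -> A := match fintype.split r with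
  inl k => one_minus_col letter (emb k) | inr _ => fun x => - letter x j end.
have fl k : f (lshift 1 k) = emb k.
  by rewrite /f (_ : lshift 1 k = unsplit (inl k)) ?unsplitK.
have fr k : f (rshift n k) = i.
  by rewrite /f (_ : rshift n k = unsplit (inr k)) ?unsplitK.
have pl k : psi (lshift 1 k) = one_minus_col letter (emb k).
  by rewrite /psi (_ : lshift 1 k = unsplit (inl k)) ?unsplitK.
have pr k : psi (rshift n k) = fun x => - letter x j.
  by rewrite /psi (_ : rshift n k = unsplit (inr k)) ?unsplitK.
rewrite (@mxdet_wedges_imset _ _ f psi); last 2 first.
- move=> x y; rewrite -(splitK x) -(splitK y).
  case: (fintype.split x) => k; case: (fintype.split y) => l /=; rewrite ?fl ?fr /=.
  + by [].
  + by rewrite (leq_trans (ltn_ord k) ni) ord1 addn0 ltn_ord.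
  + rewrite !ltnNge (leq_trans (ltnW (ltn_ord l)) ni).
    by rewrite (leq_trans (ltnW (ltn_ord l)) (leq_addr _ _)).
  by rewrite !ltnn ord1 [l]ord1 ltnn.
- move=> x y; rewrite -(splitK x) -(splitK y).
  case: (fintype.split x) => k; case: (fintype.split y) => l /=; rewrite ?fl ?fr ?pl ?pr /bordered_mx.
  + by rewrite block_mxEul !mxE.
  + by rewrite block_mxEur !mxE.
  + rewrite block_mxEdl !mxE /one_minus_col /basis_vec.
    case: eqVneq => [E|_]; last by rewrite sub0r.
    by move: ni; rewrite E leqNgt /= ltn_ord.
  by rewrite block_mxEdr !mxE ord1 [l]ord1 eqxx.
rewrite enum_setTE enum_ord_add1 -enum_setTE.
rewrite wedges_rcons pr.
have -> : (f @: [set: 'I_(n + 1)])%SET = (i |: L)%SET.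
  apply/setP => x; rewrite !inE; apply/imsetP/orP => [[r _ ->]|].
    rewrite -(splitK r); case: (fintype.split r) => k /=; rewrite ?fl ?fr ?eqxx; last by left.
    by right; rewrite /= ltn_ord.
  case=> [/eqP ->|xn]; first by exists (rshift n ord0); rewrite ?fr.
  by exists (lshift 1 (Ordinal xn)); rewrite ?fl //; apply: val_inj.
rewrite /bordered_det; congr wedge; apply/funext => K'.
rewrite wedges_map -enum_emb wedges_map; apply: wedges_eq => k x _ _.
by rewrite pl.
Qed.

End Corner.
End SeriesDeterminants.

(** * Closed sets of series and truncation *)

Section Approximation.
Set Implicit Arguments.
Unset Strict Implicit.
Import GRing.Theory.
Variables (K : fieldType) (V : choiceType).

(** Convergence is coefficientwise over a discrete field, and the coefficient of [w] in the
    approximants is constant once [N] exceeds the length of [w]. *)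
Lemma closed_ncfps_approx (I : set (ncfps K V)) (f : ncfps K V) : closed I ->
  (forall N, exists2 g, I g & forall w, (size w < N)%N -> g w = f w) -> I f.
Proof.
move=> clI appr; apply: clI.
have /choice[g Hg] : forall N, exists g, I g /\ forall w, (size w < N)%N -> g w = f w.
  by move=> N; have [g ? ?] := appr N; exists g.
have gcvg : cvg_to (fmap g \oo%classic) (nbhs f).
  apply/cvg_sup => w U [W [[W' oW <-] /= WfN WU]].
  apply: (filterS WU); change (\oo%classic (g @^-1` ((fun h : ncfps K V => h w) @^-1` W'))%classic); exists (size w).+1 => // N /= wN.
  by rewrite (proj2 (Hg N)).
move=> A /gcvg [N _ An].
exists (g N); split; [by case: (Hg N) | by apply: An => /=].
Qed.

End Approximation.

(** * Weighing words, and its failure to be multiplicative *)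

Section Twist.
Set Implicit Arguments.
Unset Strict Implicit.
Import GRing.Theory.
Variables (K : fieldType) (m : nat) (q : 'I_m -> 'I_m -> K).
Hypothesis q_neq0 : forall i j : 'I_m, (i < j)%N -> q i j != 0.
Local Notation V := ('I_m * 'I_m)%type.
Local Notation A := (ncfps K V).
Local Notation letter := (@letter K m).
Local Notation twist := (weigh_words q).
Implicit Types (u v la mu : seq 'I_m) (w : seq V) (f g h : A).

(** The factor of the inversions with one letter in [u] and the other in [v]; unlike the weight of a
    word it ignores the order within [u] and [v]. *)
Definition crossing u v : K := \prod_(x <- u) \prod_(y <- v | (y < x)%N) q y x.

Definition word_weight u : K := big_inv *%R (fun x y => q y x) u.

Lemma weightE la mu : weight q la mu = word_weight mu / word_weight la.
Proof. by rewrite /weight prodfV. Qed.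

Lemma crossing_neq0 u v : crossing u v != 0.
Proof.
rewrite prodf_seq_neq0; apply/allP => x _ /=.
by rewrite prodf_seq_neq0; apply/allP => y _; apply/implyP; apply: q_neq0.
Qed.

Lemma weight_cat la mu la' mu' : weight q (la ++ la') (mu ++ mu') =
  crossing mu mu' / crossing la la' * (weight q la mu * weight q la' mu').
Proof.
rewrite !weightE /word_weight !big_inv_cat -/(crossing _ _) -/(crossing la la').
by rewrite !invfM -mulrACA; congr (_ * _); rewrite mulrACA.
Qed.

Lemma crossing_perm u u' v v' :
  perm_eq u u' -> perm_eq v v' -> crossing u v = crossing u' v'.
Proof.
move=> uu' vv'; rewrite /crossing (perm_big _ uu'); apply: eq_bigr => x _.
exact: perm_big.
Qed.

Lemma crossing_catl u u' v : crossing (u ++ u') v = crossing u v * crossing u' v.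
Proof. by rewrite /crossing big_cat. Qed.

Lemma crossing_catr u v v' : crossing u (v ++ v') = crossing u v * crossing u v'.
Proof.
by rewrite /crossing -big_split; apply: eq_bigr => x _; rewrite big_cat.
Qed.

Lemma twistM f g (k : K) :
  (forall w w', f w != 0 -> g w' != 0 -> crossing (unzip2 w) (unzip2 w') =
     k * crossing (unzip1 w) (unzip1 w')) ->
  twist (f * g) = k *: (twist f * twist g).
Proof.
move=> fg; apply/funext => w; rewrite ncfpsZ /weigh_words !ncfpsM !mulr_sumr.
apply: eq_bigr => i _; have [->|f0] := eqVneq (f (take i w)) 0.
  by rewrite mul0r !mulr0 mul0r mulr0.
have [->|g0] := eqVneq (g (drop i w)) 0; first by rewrite !mulr0.
rewrite -{1 2}(cat_take_drop i w) /unzip1 /unzip2 !map_cat weight_cat fg //.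
rewrite mulfK ?crossing_neq0 // -[LHS]mulrA; congr (k * _).
exact: mulrACA.
Qed.

Lemma twistZ (k : K) f : twist (k *: f) = k *: twist f.
Proof. by apply/funext => w; rewrite /weigh_words !ncfpsZ mulrCA. Qed.

Lemma twistD f g : twist (f + g) = twist f + twist g.
Proof. by apply/funext => w; rewrite /weigh_words !ncfpsD mulrDr. Qed.

Lemma twistN f : twist (- f) = - twist f.
Proof. by apply/funext => w; rewrite /weigh_words !ncfpsN mulrN. Qed.

Lemma twist_sign k f : twist ((-1) ^+ k * f) = (-1) ^+ k * twist f.
Proof. by rewrite -signr_odd; case: odd; rewrite ?mul1r // !mulN1r twistN. Qed.

Lemma twist_sum (I : Type) (r : seq I) (P : pred I) (F : I -> A) :
  twist (\sum_(i <- r | P i) F i) = \sum_(i <- r | P i) twist (F i).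
Proof.
apply/funext => w; rewrite /weigh_words !ncfps_sumE mulr_sumr.
by apply: eq_bigr.
Qed.

Lemma twist1 : twist 1 = 1.
Proof.
by apply/funext => -[|p w]; rewrite /weigh_words ncfps1E ?weight_nil ?mulr1 // mulr0.
Qed.

Definition bidegree_part (rho gam : seq 'I_m) f : A := fun w =>
  if perm_eq (unzip1 w) rho && perm_eq (unzip2 w) gam then f w else 0.

Lemma letterMrE i j f w p : (f * letter i j) (rcons w p) = f w * (p == (i, j))%:R.
Proof.
rewrite ncfpsM size_rcons big_ord_recr /= big_ord_recr /= big1 => [|k _].
  rewrite add0r -(size_rcons w p) drop_size /Defs.letter /ncfps_var /= mulr0 addr0.
  by rewrite -!cats1 take_size_cat // drop_size_cat // eqseq_cons andbT.
rewrite /Defs.letter /ncfps_var -cats1 drop_cat ltn_ord.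
case E: (drop k w) => [|a s]; last by case: s E => [|? ?] _; rewrite /= eqseq_cons andbF mulr0.
by have := ltn_ord k; rewrite -subn_gt0 -size_drop E.
Qed.

(** * Pulling a closed ideal back to q = 1 *)

Section TwistedIdeal.
Variable I : set A.
Hypotheses (idealI : two_sided_ideal I) (closedI : closed I).
Hypothesis relI : (right_quantum_relators q `<=` I)%classic.

Lemma tsideal0 : I 0. Proof. by case: idealI. Qed.

Lemma tsidealD f g : I f -> I g -> I (f + g).
Proof. by case: idealI => _ + _; apply. Qed.

Lemma tsidealMl f g : I g -> I (f * g).
Proof. by case: idealI => _ _ /(_ f g 1) + Ig; rewrite mulr1; apply. Qed.

Lemma tsidealMr f g : I g -> I (g * f).
Proof. by case: idealI => _ _ /(_ 1 g f) + Ig; rewrite mul1r; apply. Qed.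

Lemma tsidealZ (k : K) f : I f -> I (k *: f).
Proof. by move=> If; rewrite -[f]mul1r scalerAl; apply: tsidealMl. Qed.

(* twist turns the relators at q = 1 into the q-relators, but it is only      *)
(* multiplicative up to scalars that depend on the multisets of row and       *)
(* column labels; hence the pull-back of I is taken one bidegree at a time.   *)
Definition untwisted : A -> Prop := fun f =>
  forall rho gam, I (bidegree_part rho gam (twist f)).

Lemma untwisted0 : untwisted 0.
Proof.
move=> rho gam; rewrite (_ : bidegree_part _ _ _ = 0); first exact: tsideal0.
by apply/funext => w; rewrite /bidegree_part /weigh_words mulr0 if_same.
Qed.

Lemma untwistedD f g : untwisted f -> untwisted g -> untwisted (f + g).
Proof.
move=> Jf Jg rho gam; have := tsidealD (Jf rho gam) (Jg rho gam).
congr (I _); apply/funext => w; rewrite ncfpsD /bidegree_part twistD ncfpsD.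
by case: ifP => //; rewrite addr0.
Qed.

Lemma untwistedZ (k : K) f : untwisted f -> untwisted (k *: f).
Proof.
move=> Jf rho gam; have := tsidealZ k (Jf rho gam).
congr (I _); apply/funext => w; rewrite ncfpsZ /bidegree_part twistZ ncfpsZ.
by case: ifP => //; rewrite mulr0.
Qed.

Lemma untwisted_sum (T : Type) (r : seq T) (F : T -> A) :
  (forall i, untwisted (F i)) -> untwisted (\sum_(i <- r) F i).
Proof.
by move=> JF; elim/big_ind: _ => //; [exact: untwisted0 | exact: untwistedD].
Qed.

(** A bidegree part only sees words of one length, so a truncation of [f] determines it. *)
Lemma untwisted_lim f :
  (forall N, exists2 g, untwisted g & forall w, (size w < N)%N -> g w = f w) ->
  untwisted f.
Proof.
move=> appr rho gam; have [g Jg fg] := appr (size rho).+1.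
have := Jg rho gam; congr (I _); apply/funext => w.
rewrite /bidegree_part; case: andP => // -[/perm_size sw _].
by rewrite /weigh_words fg // ltnS -sw size_map.
Qed.

Lemma perm_cons_rem (T : eqType) (x : T) s t : x \in s ->
  perm_eq (x :: t) s = perm_eq t (rem x s).
Proof. by move=> /perm_to_rem/permPr ->; rewrite perm_cons. Qed.

(** Within one bidegree the labels remaining after the letter are known as multisets, so the factor
    across the cut is a single scalar. *)
Lemma untwisted_letterl a b f : untwisted f -> untwisted (letter a b * f).
Proof.
move=> Jf rho gam; case: (boolP ((a \in rho) && (b \in gam))) => ab; last first.
  rewrite (_ : bidegree_part _ _ _ = 0); first exact: tsideal0.
  apply/funext => w; rewrite /bidegree_part; case: ifP => // /andP[w1 w2].
  rewrite /weigh_words letterME; case: w w1 w2 => [|p w] w1 w2; first by rewrite mulr0.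
  case: eqP => [E|_]; last by rewrite mul0r mulr0.
  by case/negP: ab; rewrite -(perm_mem w1) -(perm_mem w2) E /= !mem_head.
case/andP: ab => ar bg.
rewrite (_ : bidegree_part _ _ _ =
  (crossing [:: b] (rem b gam) / crossing [:: a] (rem a rho)) *:
  (letter a b * bidegree_part (rem a rho) (rem b gam) (twist f))).
  by apply: tsidealZ; apply: tsidealMl; apply: Jf.
apply/funext => w; rewrite ncfpsZ letterME /bidegree_part /weigh_words letterME.
case: w => [|p w]; first by rewrite !mulr0 if_same.
case: eqP => [->|_]; last by rewrite !mul0r !mulr0 if_same.
rewrite !mul1r /= !perm_cons_rem //; case: ifP => [/andP[w1 w2]|_]; last by rewrite mulr0.
rewrite -(cat1s a) -(cat1s b) weight_cat.
rewrite (crossing_perm (perm_refl _) w1) (crossing_perm (perm_refl _) w2).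
by rewrite weightE /word_weight !big_inv_cons !big_inv_nil !big_nil /= !mulr1 divr1 mul1r -mulrA.
Qed.

Lemma untwisted_letterr a b f : untwisted f -> untwisted (f * letter a b).
Proof.
move=> Jf rho gam; case: (boolP ((a \in rho) && (b \in gam))) => ab; last first.
  rewrite (_ : bidegree_part _ _ _ = 0); first exact: tsideal0.
  apply/funext => w; rewrite /bidegree_part; case: ifP => // /andP[w1 w2].
  rewrite /weigh_words; case/lastP: w w1 w2 => [|w p] w1 w2.
    by rewrite ncfpsM_nil /letter /ncfps_var /= !mulr0.
  rewrite letterMrE; case: eqP => [E|_]; last by rewrite !mulr0.
  case/negP: ab; rewrite -(perm_mem w1) -(perm_mem w2) E /unzip1 /unzip2 !map_rcons.
  by rewrite !mem_rcons !mem_head.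
case/andP: ab => ar bg.
rewrite (_ : bidegree_part _ _ _ =
  (crossing (rem b gam) [:: b] / crossing (rem a rho) [:: a]) *:
  (bidegree_part (rem a rho) (rem b gam) (twist f) * letter a b)).
  by apply: tsidealZ; apply: tsidealMr; apply: Jf.
apply/funext => w; rewrite ncfpsZ.
case/lastP: w => [|w p].
  by rewrite /bidegree_part /weigh_words !ncfpsM_nil /letter /ncfps_var /= !mulr0 if_same.
rewrite letterMrE /bidegree_part /weigh_words letterMrE.
case: eqP => [->|_]; last by rewrite !mulr0 if_same.
rewrite !mulr1 /unzip1 /unzip2 !map_rcons.
rewrite !(perm_rcons, perm_sym _ (rcons _ _)) !perm_cons_rem //.
case: ifP => [/andP[w1 w2]|_]; last by rewrite mulr0.
rewrite -!cats1 weight_cat.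
rewrite (crossing_perm w1 (perm_refl _)) (crossing_perm w2 (perm_refl _)).
rewrite [weight q [:: _] _]weightE /word_weight !big_inv_cons !big_inv_nil !big_nil /=.
by rewrite !mulr1 divr1 mulr1 -mulrA.
Qed.

Lemma untwistedMl f g : untwisted g -> untwisted (f * g).
Proof.
move=> Jg; apply: untwisted_lim => N; elim: N f => [|N IHN] f.
  by exists 0; [exact: untwisted0 | ].
have /choice[G HG] : forall p : V, exists g', untwisted g' /\
    forall w, (size w < N)%N -> g' w = (ncfps_lder p f * g) w.
  by move=> p; have [g' ? ?] := IHN (ncfps_lder p f); exists g'.
(* The series [f] is split by the first letter of its words. *)
exists (f [::] *: g + \sum_(p : V) letter p.1 p.2 * G p).
  apply: untwistedD; first exact: untwistedZ.
  by apply: untwisted_sum => p; apply: untwisted_letterl; case: (HG p).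
move=> w; rewrite ncfpsD ncfpsZ ncfps_sumE; case: w => [|p w] sw.
  by rewrite ncfpsM_nil big1 ?addr0 // => p _; rewrite letterME.
rewrite (bigD1 p) //= letterME -surjective_pairing eqxx mul1r big1 => [|p' pp'].
  by rewrite addr0 (proj2 (HG p)) // [RHS]ncfps_mul_cons.
by rewrite letterME -surjective_pairing eq_sym (negPf pp') mul0r.
Qed.

Lemma ncfps_lderE h : h = (h [::])%:A + \sum_(p : V) letter p.1 p.2 * ncfps_lder p h.
Proof.
apply/funext => w; rewrite ncfpsD ncfpsZ ncfps_sumE ncfps1E.
case: w => [|p w] /=; first by rewrite mulr1 big1 ?addr0 // => p _; rewrite letterME.
rewrite mulr0 add0r (bigD1 p) //= letterME -surjective_pairing eqxx mul1r big1 ?addr0 //.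
by move=> p' pp'; rewrite letterME -surjective_pairing eq_sym (negPf pp') mul0r.
Qed.

(* The order of vanishing k of g grows by one with each letter moved from h   *)
(* to g.                                                                      *)
Lemma untwistedMr_approx N k g h : untwisted g ->
  (forall w, (size w < k)%N -> g w = 0) ->
  exists2 g', untwisted g' & forall w, (size w < k + N)%N -> g' w = (g * h) w.
Proof.
elim: N k g h => [|N IHN] k g h Jg g0.
  exists 0 => [|w]; first exact: untwisted0.
  rewrite addn0 => wk; rewrite ncfpsM big1 // => i _.
  by rewrite g0 ?mul0r // (leq_ltn_trans _ wk) // size_take_min geq_minr.
have /choice[G HG] : forall p : V, exists g', untwisted g' /\
    forall w, (size w < k.+1 + N)%N ->
      g' w = (g * letter p.1 p.2 * ncfps_lder p h) w.
  move=> p; have [||g' ? ?] := IHN k.+1 (g * letter p.1 p.2) (ncfps_lder p h).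
  - exact: untwisted_letterr.
  - move=> w; case/lastP: w => [_|w p' ].
      by rewrite ncfpsM_nil /letter /ncfps_var /= mulr0.
    by rewrite size_rcons ltnS letterMrE => /g0 ->; rewrite mul0r.
  by exists g'.
exists (h [::] *: g + \sum_(p : V) G p).
  apply: untwistedD; first exact: untwistedZ.
  by apply: untwisted_sum => p; case: (HG p).
move=> w; rewrite addnS -addSn => wk.
rewrite [in RHS](ncfps_lderE h) mulrDr -scalerAr mulr1 !ncfpsD mulr_sumr !ncfps_sumE.
by congr (_ + _); apply: eq_bigr => p _; rewrite (proj2 (HG p)) // mulrA.
Qed.

Lemma untwistedM f g h : untwisted g -> untwisted (f * g * h).
Proof.
move=> Jg; apply: untwisted_lim => N; rewrite -[N]add0n.
by apply: untwistedMr_approx => //; apply: untwistedMl.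
Qed.

Lemma letter2E a b c d w :
  (letter a b * letter c d) w = (w == [:: (a, b); (c, d)])%:R.
Proof.
rewrite letterME; case: w => [|p w] //=.
by rewrite /Defs.letter /ncfps_var eqseq_cons -natrM mulnb.
Qed.

Lemma twist_letter2 a b c d : twist (letter a b * letter c d) =
  ((if (d < b)%N then q d b else 1) / (if (c < a)%N then q c a else 1)) *:
  (letter a b * letter c d).
Proof.
apply/funext => w; rewrite ncfpsZ /weigh_words letter2E.
case: eqP => [->|_]; last by rewrite !mulr0.
rewrite weightE /word_weight /= !big_inv_cons !big_inv_nil !big_nil /= !mulr1.
by rewrite !(big_mkcond (fun _ => (_ < _)%N)) !big_seq1.
Qed.

(** All words of [f] have one bidegree, so a part is [f] itself or 0; this serves for the
    relators. *)
Lemma bidegree_part_ideal rho gam rho0 gam0 f :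
  (forall w, f w != 0 -> perm_eq (unzip1 w) rho0 && perm_eq (unzip2 w) gam0) ->
  I f -> I (bidegree_part rho gam f).
Proof.
move=> supp If; have [E|nE] := boolP (perm_eq rho0 rho && perm_eq gam0 gam).
  rewrite (_ : bidegree_part _ _ _ = f) //; apply/funext => w.
  rewrite /bidegree_part; case: ifP => // nw; apply/eqP; rewrite eq_sym; apply: contraFT nw.
  move=> /supp/andP[w1 w2]; case/andP: E => E1 E2.
  by rewrite (perm_trans w1 E1) (perm_trans w2 E2).
rewrite (_ : bidegree_part _ _ _ = 0); first exact: tsideal0.
apply/funext => w; rewrite /bidegree_part; case: ifP => // /andP[w1 w2].
apply/eqP; apply: contraNT nE => /supp/andP[w1' w2'].
by rewrite perm_sym in w1'; rewrite perm_sym in w2'; 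
  rewrite (perm_trans w1' w1) (perm_trans w2' w2).
Qed.

Lemma untwisted_col (i j k : 'I_m) : (i < j)%N ->
  untwisted (letter j k * letter i k - letter i k * letter j k).
Proof.
move=> ij rho gam; apply: (@bidegree_part_ideal _ _ [:: i; j] [:: k; k]).
  move=> w; rewrite /weigh_words ncfpsD ncfpsN !letter2E.
  case: (w =P [:: (j, k); (i, k)]) => [->|_] /=.
    by rewrite (perm_catC [:: j] [:: i]) !perm_refl.
  by case: (w =P _) => [->|_] /=; rewrite ?perm_refl // subrr mulr0 eqxx.
rewrite twistD twistN !twist_letter2 ltnn ij ltnNge ltnW //= !div1r invr1 scale1r.
have R : right_quantum_relators q
    (letter j k * letter i k - q i j *: (letter i k * letter j k)).
  by left; exists i, j, k.
(* The twisted relator is the q-relator divided by [q i j]. *)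
have := tsidealZ (q i j)^-1 (relI R).
by rewrite scalerBr scalerA mulVf ?q_neq0 // scale1r.
Qed.

Lemma untwisted_cross (i j k l : 'I_m) : (i < j)%N -> (k < l)%N ->
  untwisted ((letter i k * letter j l - letter j k * letter i l) -
    (letter j l * letter i k - letter i l * letter j k)).
Proof.
move=> ij kl rho gam; apply: (@bidegree_part_ideal _ _ [:: i; j] [:: k; l]).
  move=> w; rewrite /weigh_words !(ncfpsD, ncfpsN) !letter2E.
  have pij : perm_eq [:: j; i] [:: i; j] by rewrite (perm_catC [:: j] [:: i]).
  have pkl : perm_eq [:: l; k] [:: k; l] by rewrite (perm_catC [:: l] [:: k]).
  do 4 (case: (w =P _) => [->|_] /=; first by rewrite ?pij ?pkl ?perm_refl).
  by rewrite !subrr mulr0 eqxx.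
rewrite !(twistD, twistN) !twist_letter2 ij kl ltnNge ltnW //= ltnNge ltnW //=.
have R : right_quantum_relators q
    ((letter i k * letter j l - (q i j)^-1 *: (letter j k * letter i l))
     - ((q k l * (q i j)^-1) *: (letter j l * letter i k)
        - q k l *: (letter i l * letter j k))).
  by right; exists i, j, k, l.
by have := relI R; rewrite !div1r !divr1 ?invr1 scale1r.
Qed.

(* A series is the limit of the sums of its bidegree parts; listing each      *)
(* bidegree once requires sorted label sequences.                             *)
Lemma untwistedP f : untwisted f -> I (twist f).
Proof.
move=> Jf; apply: closed_ncfps_approx => // N.
pose ordered (u : seq 'I_m) := sorted (fun x y : 'I_m => x <= y)%N u.
exists (\sum_(k < N) \sum_(rho : k.-tuple 'I_m | ordered rho)
   \sum_(gam : k.-tuple 'I_m | ordered gam) bidegree_part rho gam (twist f)).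
  have Isum (T : Type) (r : seq T) (P : pred T) (F : T -> A) :
      (forall i, I (F i)) -> I (\sum_(i <- r | P i) F i).
    by move=> IF; elim/big_ind: _ => //; [exact: tsideal0 | exact: tsidealD].
  by do 3 (apply: (Isum) => ?); apply: Jf.
move=> w wN.
have sortP (u : seq 'I_m) : exists2 t : (size u).-tuple 'I_m, ordered t &
    forall t' : (size u).-tuple 'I_m, ordered t' -> perm_eq u t' = (t' == t).
  pose le := (fun x y : 'I_m => x <= y)%N.
  have leT : total le by move=> x y; apply: leq_total.
  have leTr : transitive le by move=> x y z; apply: leq_trans.
  have leA : antisymmetric le by move=> x y /anti_leq/val_inj.
  have st : size (sort le u) == size u by rewrite size_sort.
  exists (Tuple st); first exact: sort_sorted.
  move=> t' ot'; apply/idP/eqP => [ut'|->]; last by rewrite perm_sym perm_sort.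
  apply/val_inj/(sorted_eq leTr leA) => //=; first exact: sort_sorted.
  by rewrite perm_sym perm_sort.
rewrite ncfps_sumE (bigD1 (Ordinal wN)) //= [X in _ + X]big1 ?addr0; last first.
  move=> k kw; rewrite ncfps_sumE big1 // => rho _; rewrite ncfps_sumE big1 // => gam _.
  rewrite /bidegree_part; case: ifP => // /andP[/perm_size]; rewrite size_map size_tuple.
  by move=> E; case/eqP: kw; apply: val_inj.
have := sortP (unzip1 w); have := sortP (unzip2 w).
rewrite !size_map => -[t2 o2 E2] [t1 o1 E1].
rewrite ncfps_sumE (bigD1 t1) //= [X in _ + X]big1 ?addr0; last first.
  move=> rho /andP[orho nrho]; rewrite ncfps_sumE big1 // => gam _.
  by rewrite /bidegree_part E1 // (negPf nrho).
rewrite ncfps_sumE (bigD1 t2) //= [X in _ + X]big1 ?addr0; last first.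
  by move=> gam /andP[ogam ngam]; rewrite /bidegree_part E2 // (negPf ngam) andbF.
by rewrite /bidegree_part E1 // E2 // !eqxx.
Qed.

End TwistedIdeal.
End Twist.

(** * Row and column labels of the words of a series *)

Section LabelTypes.
Set Implicit Arguments.
Unset Strict Implicit.
Import GRing.Theory.
Variables (K : fieldType) (m n : nat).
Local Notation V := ('I_m * 'I_m)%type.
Local Notation A := (ncfps K V).
Local Notation letter := (@letter K m).
Implicit Types (u v la mu : seq 'I_m) (w : seq V) (f g h : A).

Local Notation high := (fun x : 'I_m => n <= x)%N.

(* The row labels of each word of f are la, its column labels are mu, up to   *)
(* order and up to a common multiset of labels below n. The first condition   *)
(* is a cancelled form of this, which also covers the entries of 1 - A.       *)
Definition has_labels la mu f := forall w, f w != 0 ->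
  [/\ perm_eq (unzip1 w ++ mu) (unzip2 w ++ la),
      perm_eq (seq.filter high (unzip1 w)) (seq.filter high la) &
      perm_eq (seq.filter high (unzip2 w)) (seq.filter high mu)].

Lemma has_labelsD la mu f g :
  has_labels la mu f -> has_labels la mu g -> has_labels la mu (f + g).
Proof.
move=> lf lg w; rewrite ncfpsD; have [->|f0 _] := eqVneq (f w) 0.
  by rewrite add0r; apply: lg.
exact: lf.
Qed.

Lemma has_labels0 la mu : has_labels la mu 0.
Proof. by move=> w; rewrite eqxx. Qed.

Lemma has_labelsZ k la mu f : has_labels la mu f -> has_labels la mu (k *: f).
Proof.
by move=> lf w; rewrite ncfpsZ mulf_eq0 negb_or => /andP[_ /lf].
Qed.

Lemma has_labelsN la mu f : has_labels la mu f -> has_labels la mu (- f).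
Proof. by rewrite -scaleN1r; apply: has_labelsZ. Qed.

Lemma has_labels_sum (I : Type) (r : seq I) (P : pred I) (F : I -> A) la mu :
  (forall i, has_labels la mu (F i)) -> has_labels la mu (\sum_(i <- r | P i) F i).
Proof.
by move=> lF; elim/big_ind: _ => //; [exact: has_labels0 | exact: has_labelsD].
Qed.

Lemma has_labels1 : has_labels [::] [::] 1.
Proof. by case=> [|p w] //; rewrite eqxx. Qed.

Lemma has_labelsM la mu la' mu' f g :
  has_labels la mu f -> has_labels la' mu' g ->
  has_labels (la ++ la') (mu ++ mu') (f * g).
Proof.
move=> lf lg w; rewrite ncfpsM => nz.
have [k] : exists k : 'I_(size w).+1, f (take k w) * g (drop k w) != 0.
  apply/existsP; apply: contraNT nz; rewrite negb_exists => /forallP z.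
  by rewrite big1 // => k _; apply/eqP; rewrite -[_ == _]negbK.
rewrite mulf_eq0 negb_or => /andP[/lf[b1 r1 c1] /lg[b2 r2 c2]].
rewrite -(cat_take_drop k w) /unzip1 /unzip2 !map_cat !filter_cat.
split; [|exact: perm_cat|exact: perm_cat].
apply/seq.permP => p; have /seq.permP/(_ p) := b1; have /seq.permP/(_ p) := b2.
rewrite !count_cat => e2 e1; rewrite addnACA.
by rewrite /unzip1 /unzip2 in e1 e2; rewrite e1 e2 addnACA.
Qed.

Lemma has_labels_perm la mu la' mu' f : perm_eq la la' -> perm_eq mu mu' ->
  has_labels la mu f -> has_labels la' mu' f.
Proof.
move=> ll mm lf w /lf[b r c]; split.
- rewrite -(permPr (perm_cat (perm_refl _) ll)) -(permPl (perm_cat (perm_refl _) mm)).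
  exact: b.
- by apply: perm_trans r _; apply: perm_filter.
by apply: perm_trans c _; apply: perm_filter.
Qed.

Lemma has_labels_cancel u la mu f : all (predC high) u ->
  has_labels (u ++ la) (u ++ mu) f -> has_labels la mu f.
Proof.
move=> lu lf w /lf[b r c].
have fu : seq.filter high u = [::].
  by apply/eqP; rewrite -[_ == _]negbK -has_filter -all_predC.
rewrite !filter_cat fu in r c; split=> //.
rewrite -(perm_cat2l u) perm_catCA; apply: perm_trans b _.
by rewrite perm_catCA.
Qed.

(** The filters determine the high labels; cancelling them in the first condition leaves equal low
    labels in rows and columns, which form [u]. *)
Lemma has_labelsP la mu f w : has_labels la mu f -> all high la -> all high mu ->
  f w != 0 -> exists2 u, all (predC high) u &
    perm_eq (unzip1 w) (la ++ u) && perm_eq (unzip2 w) (mu ++ u).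
Proof.
move=> lf hla hmu /lf[b r c]; rewrite (all_filterP hla) in r; rewrite (all_filterP hmu) in c.
pose low := seq.filter (predC high).
have p1 : perm_eq (unzip1 w) (la ++ low (unzip1 w)).
  rewrite perm_sym; apply: perm_trans (permEl (perm_filterC high (unzip1 w))).
  by rewrite perm_cat2r perm_sym.
have p2 : perm_eq (unzip2 w) (mu ++ low (unzip2 w)).
  rewrite perm_sym; apply: perm_trans (permEl (perm_filterC high (unzip2 w))).
  by rewrite perm_cat2r perm_sym.
exists (low (unzip1 w)); first exact: filter_all.
rewrite p1 (perm_trans p2) // perm_cat2l.
have : perm_eq ((la ++ low (unzip1 w)) ++ mu) ((mu ++ low (unzip2 w)) ++ la).
  apply: perm_trans (perm_trans b _); last by rewrite perm_cat2r.
  by rewrite perm_cat2r perm_sym.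
move=> /seq.permP e; apply/seq.permP => p; have := e p; rewrite !count_cat.
by rewrite addnAC [in RHS]addnAC (addnC (count p mu)) => /addnI.
Qed.

Lemma has_labels_sign k la mu f :
  has_labels la mu f -> has_labels la mu ((-1) ^+ k * f).
Proof.
rewrite -signr_odd; case: odd => lf; last by rewrite mul1r.
by rewrite mulN1r; apply: has_labelsN.
Qed.

(** Each coefficient of the inverse comes from a finite geometric sum; a series without constant
    term is its own inverse by convention. *)
Lemma has_labels_inv f : has_labels [::] [::] f -> has_labels [::] [::] f^-1.
Proof.
move=> lf w; rewrite [f^-1]/(ncfps_inv f) /ncfps_inv; case: ifP => [_|_]; first exact: lf.
rewrite mulf_eq0 negb_or => /andP[_]; move: (size w).+1 => N; move: w.
suff S : has_labels [::] [::] (\sum_(k < N) (1 - (f [::])^-1 *: f) ^+ k).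
  exact: S.
apply: has_labels_sum => k.
elim: (k : nat) => [|d IHd]; first exact: has_labels1.
rewrite exprS -[[::]]/([::] ++ [::] : seq 'I_m); apply: has_labelsM => //.
apply: has_labelsD; first exact: has_labels1.
by apply: has_labelsN; apply: has_labelsZ.
Qed.

Lemma has_labels_letter i j : has_labels [:: i] [:: j] (letter i j).
Proof.
move=> w; rewrite /Defs.letter /ncfps_var; case: (w =P _) => [->|_]; last by rewrite eqxx.
by move=> _; split=> //=; rewrite (perm_catC [:: i] [:: j]).
Qed.

(** Lets the 1 on the diagonal of [1 - A_0] count as an entry with labels [i], [i]. *)
Lemma has_labels_low_unit (i : 'I_m) : (i < n)%N -> has_labels [:: i] [:: i] 1.
Proof.
by move=> lti [|p w]; rewrite ?eqxx // => _; split=> //=; rewrite leqNgt lti.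
Qed.

Lemma has_labels_mxdet (N : nat) (B : 'M[A]_N) (f g : 'I_N -> 'I_m) :
  (forall x r, has_labels [:: f x] [:: g r] (B x r)) ->
  has_labels [seq f r | r <- enum 'I_N] [seq g r | r <- enum 'I_N] (mxdet B).
Proof.
move=> lB; apply: has_labels_sum => s; apply: has_labels_sign.
apply: (@has_labels_perm [seq f (s r) | r <- enum 'I_N] _) (perm_refl _) _.
  rewrite (map_comp f s); apply: perm_map; apply: uniq_perm.
  - by rewrite map_inj_uniq ?enum_uniq //; apply: perm_inj.
  - exact: enum_uniq.
  move=> x; rewrite mem_enum; apply/mapP; exists (s^-1%g x); rewrite ?mem_enum //.
  by rewrite permKV.
rewrite [index_enum _]unlock -enumT; elim: (enum 'I_N) => [|r js IHjs] /=.
  by rewrite big_nil; apply: has_labels1.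
rewrite big_cons -(cat1s (f _)) -(cat1s (g _)); exact: has_labelsM.
Qed.

Section Corner.
Variable ltnm : (n < m)%N.
Local Notation emb := (widen_ord (ltnW ltnm)).

Lemma has_labels_amx0 (k l : 'I_n) :
  has_labels [:: emb k] [:: emb l] ((1%:M - amx0 K ltnm) k l).
Proof.
rewrite !mxE; apply: has_labelsD; last by apply: has_labelsN; apply: has_labels_letter.
case: eqVneq => [->|_]; last exact: has_labels0.
by rewrite mulr1n; apply: has_labels_low_unit; rewrite /= ltn_ord.
Qed.

Lemma has_labels_det_amx0 : has_labels [::] [::] (mxdet (1%:M - amx0 K ltnm)).
Proof.
apply: (@has_labels_cancel [seq emb k | k <- enum 'I_n]).
  by apply/allP => _ /mapP[k _ ->] /=; rewrite -ltnNge ltn_ord.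
by rewrite !cats0; apply: has_labels_mxdet; apply: has_labels_amx0.
Qed.

Lemma has_labels_bordered (i j : 'I_m) : (n <= i)%N -> (n <= j)%N ->
  has_labels [:: i] [:: j] (mxdet (bordered_mx K ltnm i j)).
Proof.
move=> ni nj; pose lab (z : 'I_m) (r : 'I_(n + 1)) := match fintype.split r with
  inl k => emb k | inr _ => z end.
have labl z k : lab z (lshift 1 k) = emb k.
  by rewrite /lab (_ : lshift 1 k = unsplit (inl k)) ?unsplitK.
have labr z k : lab z (rshift n k) = z.
  by rewrite /lab (_ : rshift n k = unsplit (inr k)) ?unsplitK.
have labE z : perm_eq [seq lab z r | r <- enum 'I_(n + 1)]
    ([seq emb k | k <- enum 'I_n] ++ [:: z]).
  by rewrite enum_ord_add1 map_rcons -map_comp /= labr (eq_map (labl z)) cats1.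
apply: (@has_labels_cancel [seq emb k | k <- enum 'I_n]).
  by apply/allP => _ /mapP[k _ ->] /=; rewrite -ltnNge ltn_ord.
apply: (has_labels_perm (labE i) (labE j)); apply: has_labels_mxdet => x y.
rewrite -(splitK x) -(splitK y).
case: (fintype.split x) => k; case: (fintype.split y) => l /=; rewrite ?labl ?labr /bordered_mx.
- by rewrite block_mxEul; apply: has_labels_amx0.
- by rewrite block_mxEur !mxE; apply: has_labelsN; apply: has_labels_letter.
- by rewrite block_mxEdl !mxE; apply: has_labelsN; apply: has_labels_letter.
rewrite block_mxEdr !mxE ord1 [l]ord1 eqxx.
by apply: has_labelsN; apply: has_labels_letter.
Qed.

End Corner.
End LabelTypes.

(** * Transport of the identity from q = 1 to general q *)

Section QSchur.
Set Implicit Arguments.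
Unset Strict Implicit.
Import GRing.Theory.
Variables (K : fieldType) (m n : nat) (q : 'I_m -> 'I_m -> K).
Hypothesis q_neq0 : forall i j : 'I_m, (i < j)%N -> q i j != 0.
Hypothesis q_const : forall i i' j j' : 'I_m, (i < n)%N -> (i' < n)%N ->
  (n <= j)%N -> (n <= j')%N -> q i j = q i' j'.
Local Notation V := ('I_m * 'I_m)%type.
Local Notation A := (ncfps K V).
Local Notation letter := (@letter K m).
Local Notation twist := (weigh_words q).
Local Notation high := (fun x : 'I_m => n <= x)%N.
Implicit Types (u la mu : seq 'I_m) (w : seq V) (f g : A).

Lemma crossing_low_high u mu : all (predC high) u -> all high mu ->
  crossing q u mu = 1.
Proof.
move=> /allP lu /allP hmu; rewrite /crossing big_seq big1 // => x /lu /= xn.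
rewrite big_seq_cond big1 // => y /andP[/hmu /= ny yx].
by rewrite (leq_trans ny (ltnW yx)) in xn.
Qed.

(** Here the constancy of [q] enters: each pair of a high and a low label is an inversion with the
    same factor, so only the lengths count. *)
Lemma crossing_high_low la mu u : size la = size mu -> all high la ->
  all high mu -> all (predC high) u -> crossing q la u = crossing q mu u.
Proof.
move=> + + + /allP lu; elim: la mu => [|x la IHla] [|y mu] //= [slm].
move=> /andP[nx hla] /andP[ny hmu]; rewrite /crossing !big_cons.
rewrite -/(crossing q la u) -/(crossing q mu u) (IHla mu) //; congr (_ * _).
rewrite big_seq_cond [RHS]big_seq_cond; apply: eq_big => z.
  case: (boolP (z \in u)) => //= /lu /=; rewrite -ltnNge => zn.
  by rewrite !(leq_trans zn).
move=> /andP[/lu /=]; rewrite -ltnNge => zn _; exact: q_const.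
Qed.

Lemma crossing_labels la mu la' mu' f g w w' :
  size la = size mu -> all high la -> all high mu -> all high la' -> all high mu' ->
  has_labels n la mu f -> has_labels n la' mu' g -> f w != 0 -> g w' != 0 ->
  crossing q (unzip2 w) (unzip2 w') =
  crossing q mu mu' / crossing q la la' * crossing q (unzip1 w) (unzip1 w').
Proof.
move=> slm hla hmu hla' hmu' lf lg fw gw.
have [u lu /andP[w1 w2]] := has_labelsP lf hla hmu fw.
have [u' lu' /andP[w1' w2']] := has_labelsP lg hla' hmu' gw.
rewrite (crossing_perm q w1 w1') (crossing_perm q w2 w2').
rewrite !crossing_catl !crossing_catr (crossing_low_high lu hmu').
rewrite (crossing_low_high lu hla') (crossing_high_low slm hla hmu lu').
by rewrite -!mulrA mulKf ?crossing_neq0.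
Qed.

Lemma twistM_labels la mu la' mu' f g :
  size la = size mu -> all high la -> all high mu -> all high la' -> all high mu' ->
  has_labels n la mu f -> has_labels n la' mu' g ->
  twist (f * g) = (crossing q mu mu' / crossing q la la') *: (twist f * twist g).
Proof.
move=> slm hla hmu hla' hmu' lf lg; apply: twistM => // w w' fw gw.
exact: (crossing_labels slm hla hmu hla' hmu' lf lg).
Qed.

Lemma has_labels_prod (c : 'I_m -> 'I_m -> A) (s : 'I_m -> 'I_m) (js : seq 'I_m) :
  (forall i j : 'I_m, (n <= i)%N -> (n <= j)%N -> has_labels n [:: i] [:: j] (c i j)) ->
  all high js -> all high [seq s j | j <- js] ->
  has_labels n [seq s j | j <- js] js (\prod_(j <- js) c (s j) j).
Proof.
move=> lc; elim: js => [|j js IHjs] /=.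
  by move=> _ _; rewrite big_nil; apply: has_labels1.
move=> /andP[nj hjs] /andP[ns hs]; rewrite big_cons -(cat1s j) -(cat1s (s j)).
by apply: has_labelsM; [apply: lc | apply: IHjs].
Qed.

(** Across each cut the low labels contribute equally to rows and columns, so only the outer labels
    leave a factor; these accumulate to the weight used in [qdet_one_minus]. *)
Lemma twist_prod (c : 'I_m -> 'I_m -> A) (s : 'I_m -> 'I_m) (js : seq 'I_m) :
  (forall i j : 'I_m, (n <= i)%N -> (n <= j)%N -> has_labels n [:: i] [:: j] (c i j)) ->
  all high js -> all high [seq s j | j <- js] ->
  twist (\prod_(j <- js) c (s j) j) =
  weight q [seq s j | j <- js] js *: \prod_(j <- js) twist (c (s j) j).
Proof.
move=> lc; elim: js => [|j js IHjs] /=.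
  by move=> _ _; rewrite !big_nil twist1 weight_nil scale1r.
move=> /andP[nj hjs] /andP[ns hs]; rewrite !big_cons.
rewrite (@twistM_labels [:: s j] [:: j] [seq s j | j <- js] js) /= ?nj ?ns //;
  [|exact: lc|exact: has_labels_prod].
rewrite IHjs // -scalerAr scalerA -(cat1s j js) -(cat1s (s j) [seq s j | j <- js]) weight_cat.
rewrite [weight q [:: _] _]weightE /word_weight !big_inv_cons !big_inv_nil !big_nil /=.
by rewrite !mulr1 divr1 mul1r.
Qed.

Variable ltnm : (n < m)%N.
Local Notation X := (mxdet (1%:M - amx0 K ltnm)).
Local Notation H := [set x : 'I_m | (n <= x)%N]%SET.

Let X_unit : X \is a GRing.unit.
Proof.
have := qdet_amx0_unit q ltnm; rewrite !ncfps_unitE.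
by rewrite /qdet /weigh_words -/(mxdet _) weight_nil mul1r.
Qed.

(** With threshold [m] every label is low, so this says only that row and column labels agree as
    multisets. *)
Lemma has_labels_det_amx : has_labels m [::] [::] (mxdet (1%:M - amx K m)).
Proof.
apply: (@has_labels_cancel _ _ _ [seq id k | k <- enum 'I_m]).
  by apply/allP => k _ /=; rewrite -ltnNge.
rewrite !cats0; apply: has_labels_mxdet => x r; rewrite !mxE.
apply: has_labelsD; last by apply: has_labelsN; apply: has_labels_letter.
case: eqVneq => [->|_]; last exact: has_labels0.
by rewrite mulr1n; apply: has_labels_low_unit.
Qed.

Lemma twistM_balanced n' f g :
  has_labels n [::] [::] f -> has_labels n' [::] [::] g ->
  twist (f * g) = twist f * twist g.
Proof.
move=> lf lg; rewrite (twistM q_neq0 (k := 1)) ?scale1r // => w w' fw gw.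
have [b _ _] := lf _ fw; have [b' _ _] := lg _ gw; rewrite !cats0 in b b'.
by rewrite mul1r (crossing_perm q b b').
Qed.

Let X_inv_labels : has_labels n [::] [::] X^-1.
Proof. by apply: has_labels_inv; apply: has_labels_det_amx0. Qed.

Lemma twist_inv_det : twist X^-1 = (qdet q (1%:M - amx0 K ltnm))^-1.
Proof.
have U := qdet_amx0_unit q ltnm; apply: (mulIr U); rewrite mulVr //.
rewrite -[qdet _ _]/(twist X) -(twistM_balanced X_inv_labels (@has_labels_det_amx0 K _ _ ltnm)).
by rewrite mulVr ?twist1.
Qed.

Lemma qdet_schur : eq_modulo (right_quantum_relators q)
  ((qdet q (1%:M - amx0 K ltnm))^-1 * qdet q (1%:M - amx K m))
  (qdet_one_minus q n (cq q ltnm)).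
Proof.
(* The generated closed ideal is an intersection, so membership is checked in each closed ideal [I]
   containing the q-relators. *)
move=> I [[idI clI] relI].
pose c i j : A := - (X^-1 * bordered_det n letter i j).
have lc (i j : 'I_m) : (n <= i)%N -> (n <= j)%N -> has_labels n [:: i] [:: j] (c i j).
  move=> ni nj; apply: has_labelsN; rewrite -(mxdet_bordered K ltnm j ni).
  rewrite -[[:: i]]/([::] ++ [:: i]) -[[:: j]]/([::] ++ [:: j]).
  by apply: has_labelsM; [|exact: has_labels_bordered].
have tc (i j : 'I_m) : (n <= i)%N -> (n <= j)%N -> twist (c i j) = cq q ltnm i j.
  move=> ni nj; rewrite twistN -(mxdet_bordered K ltnm j ni).
  rewrite (@twistM_labels [::] [::] [:: i] [:: j]) //= ?ni ?nj //; last first.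
    exact: has_labels_bordered.
  by rewrite /crossing !big_nil divr1 scale1r twist_inv_det.
have JS : untwisted q I (X^-1 * mxdet (1%:M - amx K m) -
    \sum_(S : {set 'I_m} | S \subset H) (-1) ^+ #|S| *
      wedges (fun j x => c x j) (enum S) (vac A) S).
  rewrite mxdet_amx; apply: (@manin_schur _ n _ letter (untwisted q I)
    _ _ _ _ _ (fun k j => (schur_sol K n j)^~ k : A)).
  - exact: untwisted0.
  - exact: untwistedD.
  - by move=> f g h; apply: untwistedM.
  - by move=> i j k ij; apply: untwisted_col.
  - by move=> i j k l ij kl; apply: untwisted_cross.
  - exact: schur_letter0.
  by rewrite -mxdet_amx0 mulVr.
(* The identity at q = 1 is twisted into [I], and its two sides are then matched with those for [q],
   the sum term by term. *)
have := untwistedP idI clI JS; rewrite twistD twistN.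
rewrite (twistM_balanced X_inv_labels has_labels_det_amx) twist_inv_det.
congr (I (_ - _)); rewrite twist_sum; apply: eq_bigr => S SH.
rewrite twist_sign wedges_Sym twist_sum; congr (_ * _); apply: eq_bigr => s sS.
have hS : all high (enum S).
  by apply/allP => x; rewrite mem_enum => /(fintype.subsetP SH); rewrite inE.
have hs : all high [seq s j | j <- enum S].
  apply/allP => _ /mapP[x + ->]; rewrite mem_enum => xS; rewrite inE in sS.
  rewrite -(perm_closed x sS) in xS.
  by move/fintype.subsetP: SH => /(_ _ xS); rewrite inE.
rewrite twist_sign twist_prod //; congr (_ * (_ *: _)).
rewrite big_seq [RHS]big_seq; apply: eq_bigr => j jS.
by apply: tc; [apply: (allP hs); apply: map_f | apply: (allP hS)].
Qed.

End QSchur.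

Theorem theorem1p3 (R : realType) (n m : nat) (n_gt0 : (1 <= n)%N)
    (ltnm : (n < m)%N) (q : 'I_m -> 'I_m -> R[i])
    (q_neq0 : forall i j : 'I_m, (i < j)%N -> q i j != 0)
    (q_const : forall i i' j j' : 'I_m, (i < n)%N -> (i' < n)%N ->
       (n <= j)%N -> (n <= j')%N -> q i j = q i' j') :
  eq_modulo (right_quantum_relators q)
    ((qdet q (1%:M - amx0 R[i] ltnm))^-1 * qdet q (1%:M - amx R[i] m))
    (qdet_one_minus q n (cq q ltnm)).
Proof.
  exact: qdet_schur.
Qed.
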